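(* For every convex semialgebraic set $K\subseteq\mathbb{R}^n$ one has $$\mathrm{sxdeg}(\overline{K})\le\mathrm{sosdeg}(K)\le\mathrm{sxdeg}(K),$$ where $\overline{K}$ is the closure of $K$. In particular, $\mathrm{sxdeg}(K)=\mathrm{sosdeg}(K)$ if $K$ is closed.
   Context: $\mathsf{S}^d$ is the space of real symmetric $d\times d$ matrices, $\mathsf{S}^d_+$ the cone of positive semidefinite ones. For a semialgebraic set $S\subseteq\mathbb{R}^n$ ($n\ge1$): $\mathrm{spdeg}(S)=0$ if $S$ is an affine subspace (the empty set is counted as an affine subspace); otherwise $\mathrm{spdeg}(S)$ is the smallest $d\ge1$ for which there are $m\ge1$ and an affine-linear map $\varphi\colon\mathbb{R}^n\to(\mathsf{S}^d)^m$ with $S=\varphi^{-1}\bigl((\mathsf{S}^d_+)^m\bigr)$, and $\mathrm{spdeg}(S)=\infty$ if no such $d$ exists. $S$ is a spectrahedron if $\mathrm{spdeg}(S)<\infty$. For $K\subseteq\mathbb{R}^n$, $\mathrm{sxdeg}(K)=\inf\mathrm{spdeg}(S)$ over all $s\ge1$, all affine-linear $\pi\colon\mathbb{R}^s\to\mathbb{R}^n$ and all spectrahedra $S\subseteq\mathbb{R}^s$ with $\pi(S)=K$ (infimum of the empty set is $\infty$). An affine $\mathbb{R}$-variety $X=\mathrm{Spec}(A)$ is given by a finitely generated (commutative) $\mathbb{R}$-algebra $A=\mathbb{R}[X]$, not necessarily reduced or a domain (the zero ring is allowed); $X(\mathbb{R})=\mathrm{Hom}_{\mathbb{R}}(A,\mathbb{R})$.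 A morphism $\phi\colon X\to\mathbb{A}^n$ corresponds to the pullback homomorphism $\phi^*\colon\mathbb{R}[x_1,\dots,x_n]\to\mathbb{R}[X]$ and induces a map $\phi\colon X(\mathbb{R})\to\mathbb{R}^n$. For a linear subspace $U$ of an $\mathbb{R}$-algebra, $\Sigma U^2$ is the set of all finite sums of squares of elements of $U$. For $K\subseteq\mathbb{R}^n$, $P_K=\{f\in\mathbb{R}[x_1,\dots,x_n]\colon\deg(f)\le1,\ f|_K\ge0\}$. For a convex semialgebraic set $K\subseteq\mathbb{R}^n$, $\mathrm{sosdeg}(K)$ is the smallest integer $d\ge0$ such that there exist a morphism $\phi\colon X\to\mathbb{A}^n$ of affine $\mathbb{R}$-varieties and finitely many $\mathbb{R}$-linear subspaces $U_1,\dots,U_r\subseteq\mathbb{R}[X]$ with: (1) $K\subseteq\mathrm{conv}\,\phi(X(\mathbb{R}))$; (2) $\dim(U_i)\le d$ for all $i$; (3) $\phi^*(P_K)\subseteq\mathbb{R}_{\ge0}\cdot1+\Sigma U_1^2+\cdots+\Sigma U_r^2$ in $\mathbb{R}[X]$. If there is no such $d$, $\mathrm{sosdeg}(K)=\infty$. *)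

(* Defs.v *)
From HB Require Import structures.
From mathcomp Require Import all_boot all_order all_algebra.
From mathcomp Require Import sesquilinear.
From mathcomp Require Import all_classical all_reals all_analysis.
(* The notations of [mpoly] clash with those of mathcomp-analysis; its canonical
   structures are needed. *)
From mathcomp Require Import -(notations) mpoly.

Set Implicit Arguments.
Unset Strict Implicit.
Unset Printing Implicit Defensive.

Import Order.TTheory GRing.Theory Num.Theory.
Import numFieldNormedType.Exports.

Local Open Scope classical_set_scope.
Local Open Scope ring_scope.

Local Notation "{ 'mpoly' R [ n ] }" := (mpoly n R)
  (at level 0, R at level 2, format "{ 'mpoly'  R [ n ] }").

Section AffineGeometry.
Variable R : realType.

Definition affine_map (V W : lmodType R) (f : V -> W) : Prop :=
  exists (L : {linear V -> W}) (b : W), forall x, f x = L x + b.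

Definition affine_subspace n (S : set 'rV[R]_n) : Prop :=
  S = set0 \/
  exists (x0 : 'rV[R]_n) (W : {vspace 'rV[R]_n}), S = [set x | x - x0 \in W].

Definition conv_hull n (A : set 'rV[R]_n) : set 'rV[R]_n :=
  [set x | exists (k : nat) (t : 'I_k -> R) (p : 'I_k -> 'rV[R]_n),
     [/\ forall i, 0 <= t i, \sum_(i < k) t i = 1, forall i, A (p i)
       & x = \sum_(i < k) t i *: p i]].

Definition mpeval n (f : {mpoly R[n]}) (x : 'rV[R]_n) : R :=
  meval (fun i => x 0 i) f.

(* Finite Boolean combinations of sets of the form [f > 0]. *)
Inductive semialgebraic n : set 'rV[R]_n -> Prop :=
| semialgebraic_gt0 (f : {mpoly R[n]}) : semialgebraic [set x | 0 < mpeval f x]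
| semialgebraic_setC A : semialgebraic A -> semialgebraic (~` A)
| semialgebraic_setU A B :
    semialgebraic A -> semialgebraic B -> semialgebraic (A `|` B).

End AffineGeometry.

Section Spectrahedra.
Variable R : realType.

Definition psd d (A : 'M[R]_d) : Prop :=
  A \is symmetricmx /\ forall v : 'rV[R]_d, 0 <= (v *m A *m v^T) 0 0.

Definition has_lmi n (S : set 'rV[R]_n) (d : nat) : Prop :=
  exists (m : nat) (phi : 'rV[R]_n -> {ffun 'I_m -> 'M[R]_d}),
    [/\ (0 < m)%N, affine_map phi,
        forall x i, phi x i \is symmetricmx
      & S = [set x | forall i, psd (phi x i)]].

(* Degrees live in [\bar R]; [ereal_inf] of the empty set is [+oo], and an
   infimum of a nonempty set of natural numbers is attained. *)
Definition spdeg n (S : set 'rV[R]_n) : \bar R :=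
  if `[< affine_subspace S >] then 0%E
  else ereal_inf [set (d%:R)%:E | d in [set d | (0 < d)%N /\ has_lmi S d]].

Definition spectrahedron n (S : set 'rV[R]_n) : Prop := (spdeg S < +oo)%E.

Definition sxdeg n (K : set 'rV[R]_n) : \bar R :=
  ereal_inf [set e | exists (s : nat) (pi : 'rV[R]_s -> 'rV[R]_n)
                            (S : set 'rV[R]_s),
    [/\ (0 < s)%N, affine_map pi, spectrahedron S, pi @` S = K
      & e = spdeg S]].

End Spectrahedra.

Section AffineVarieties.
Variable R : realType.

(* An R-algebra is given as a commutative ring with a structure map from R;
   [comAlgType R] would exclude the zero ring. *)
Record affine_variety := AffineVariety {
  coord_ring : comPzRingType;
  scalar_map : {rmorphism R -> coord_ring};
  coord_ring_fg : exists (m : nat) (q : {rmorphism {mpoly R[m]} -> coord_ring}),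
    (forall c, q (mpolyC m c) = scalar_map c) /\ (forall a, exists p, q p = a)
}.

Record real_point (X : affine_variety) := RealPoint {
  point_eval : {rmorphism coord_ring X -> R};
  point_eval_scalar : forall c, point_eval (scalar_map X c) = c
}.

Record morphism_to_affine_space (X : affine_variety) (n : nat) := MorphismToAn {
  pullback : {rmorphism {mpoly R[n]} -> coord_ring X};
  pullbackC : forall c, pullback (mpolyC n c) = scalar_map X c
}.

Definition point_image X n (phi : morphism_to_affine_space X n)
    (a : real_point X) : 'rV[R]_n :=
  \row_(i < n) point_eval a (pullback phi (mpolyX R (mnm1 i))).

Definition linear_subspace (X : affine_variety) (U : set (coord_ring X)) : Prop :=
  U 0 /\ forall c u v, U u -> U v -> U (scalar_map X c * u + v).

Definition dim_le (X : affine_variety) (U : set (coord_ring X)) (d : nat) : Prop :=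
  exists (k : nat) (e : 'I_k -> coord_ring X),
    [/\ (k <= d)%N, forall i, U (e i),
        forall u, U u -> exists c : 'I_k -> R, u = \sum_i scalar_map X (c i) * e i
      & forall c : 'I_k -> R,
          \sum_i scalar_map X (c i) * e i = 0 -> forall i, c i = 0].

Definition sos (A : comPzRingType) (U : set A) : set A :=
  [set f | exists k (u : 'I_k -> A),
     (forall j, U (u j)) /\ f = \sum_j u j ^+ 2].

Definition nonneg_affine n (K : set 'rV[R]_n) : set {mpoly R[n]} :=
  [set f | (mpoly.msize f <= 2)%N /\ forall x, K x -> 0 <= mpeval f x].

Definition sos_representable n (K : set 'rV[R]_n) (d : nat) : Prop :=
  exists (X : affine_variety) (phi : morphism_to_affine_space X n) (r : nat)
         (U : 'I_r -> set (coord_ring X)),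
    [/\ K `<=` conv_hull (range (point_image phi)),
        forall i, linear_subspace (U i) /\ dim_le (U i) d
      & forall f, nonneg_affine K f ->
          exists (c : R) (s : 'I_r -> coord_ring X),
            [/\ 0 <= c, forall i, sos (U i) (s i)
              & pullback phi f = scalar_map X c + \sum_i s i]].

Definition sosdeg n (K : set 'rV[R]_n) : \bar R :=
  ereal_inf [set (d%:R)%:E | d in [set d : nat | sos_representable K d]].

End AffineVarieties.

(* Main.v *)
From HB Require Import structures.
Require Import Defs.
From mathcomp Require Import all_boot all_order all_algebra.
From mathcomp Require Import sesquilinear ring lra.
From mathcomp Require Import all_classical all_reals all_analysis.
From mathcomp Require Import -(notations) mpoly.

Set Implicit Arguments.
Unset Strict Implicit.
Unset Printing Implicit Defensive.

Import Order.TTheory GRing.Theory Num.Theory.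
Import numFieldNormedType.Exports.

Local Open Scope classical_set_scope.
Local Open Scope ring_scope.

(** Positive semidefinite d x d matrices and sums of squares from a
    d-dimensional space are dual to each other; each inequality uses this in
    one direction.

    sosdeg K <= sxdeg K.  Let K = pi(S), where S is cut out by the conditions
    that the d x d matrices phi_i(x) are positive semidefinite.  Choose over
    every point of K a preimage x in S and a factorization
    phi_i(x) = Z_i^T Z_i, and let X be the affine variety whose coordinate ring
    is the algebra of functions on K generated by the coordinates and by the
    entries of the Z_i; the points of K are real points of X.  An affine
    function nonnegative on K, composed with pi, equals
    c + sum_i tr(phi_i(x) B_i) on S with c >= 0 and B_i positive semidefinite
    ([trace_duality]).  Writing B_i = W_i^T W_i turns this trace into a sum of
    squares of linear combinations of the entries of a single row of Z_i
    ([mxtrace_gram2]), so that the spans of the rows, of dimension at most d,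
    are the required subspaces.

    Strict feasibility is not assumed, so [trace_duality] has to deal with the
    failure of closedness of the cone of all c + sum_i tr(phi_i(x) B_i).  It
    disappears when functions are compared on S only, that is at finitely many
    points p_k of S that affinely span S, and when the B_i are compressed by a
    projector along the common kernel of the phi_i(p_k): then only the zero
    tuple gives the zero function and the cone is closed
    ([farkas_closed_cone]).  A function outside the cone is separated from it
    by weights z_k on the p_k; after a small perturbation they have positive
    sum, and their barycentre is a point of S where the function is negative.

    sxdeg (closure K) <= sosdeg K.  Given phi : X -> A^n and subspaces U_i,
    consider linear functionals lambda with lambda(1) = 1, on a
    finite-dimensional space of functions on X, that are nonnegative on the
    squares of the U_i.  They form a spectrahedron with blocks of size at most
    d (the Gram matrices of the forms lambda(u v)), and
    pi(lambda) = (lambda(phi^* x_j))_j is linear.  Evaluations at real points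
    of X show that the image contains K; applying lambda to the
    representations of the nonnegative affine functions shows that it is
    contained in the closure of K ([dual_image_closure]).  It remains to make
    the image closed.  For this the U_i are first shrunk to the span of the
    elements whose squares occur in the representation of some nonnegative
    affine function ([used_squares]).  A basis element e of the shrunken space
    then satisfies lambda(e^2) <= f(pi(lambda)) for an affine f, so that the
    Gram matrices, and with them lambda, stay bounded as long as pi(lambda)
    does ([dual_bounded]), and the image is closed ([dual_image]). *)

(** * Linear algebra and positive semidefinite matrices *)

Section LinearAlgebra.
Variable R : realType.

(** By induction on the number of rows: either the rows already span, and a new
    row may repeat an element of [Y], or a new row raises the rank.  The number
    of rows is prescribed because the families obtained from this lemma are
    used with a fixed index type. *)
Lemma spanning_rows k d (Y : set 'rV[R]_k) : Y !=set0 -> (k <= d)%N ->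
  exists M : 'M[R]_(d, k), (forall i, Y (row i M)) /\
    (forall v, Y v -> (v <= M)%MS).
Proof.
move=> [y0 Yy0] kd.
suff [M [YM]] : exists M : 'M[R]_(d, k), (forall i, Y (row i M)) /\
    ((forall v, Y v -> (v <= M)%MS) \/ \rank M = d).
  case=> [spM|rkM]; exists M; split=> // v _.
  apply: submx_full; rewrite /row_full rkM eqn_leq kd andbT.
  by rewrite -rkM rank_leq_col.
elim: d {kd} => [|d [M [YM dichM]]].
  exists (0 : 'M[R]_(0, k)); split=> [[]//|]; right.
  by apply/eqP; rewrite -leqn0 rank_leq_row.
have Yext v : Y v -> forall i, Y (row i (col_mx v M : 'M[R]_(1 + d, k))).
  move=> Yv i; case: (split_ordP i) => j ->.
    by rewrite rowKu [j]ord1 row_id.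
  by rewrite rowKd; exact: YM.
have subM v : (M <= (col_mx v M : 'M[R]_(1 + d, k)))%MS.
  by rewrite -addsmxE addsmxSr.
case: dichM => [spM|rkM].
  exists (col_mx y0 M); split; first exact: Yext.
  by left=> v /spM vM; apply: submx_trans vM (subM _).
have [spM|/existsNP[v /not_implyP[Yv /negP vM]]] :=
    pselect (forall v, Y v -> (v <= M)%MS).
  exists (col_mx y0 M); split; first exact: Yext.
  by left=> v /spM vM; apply: submx_trans vM (subM _).
exists (col_mx v M); split; first exact: Yext.
right; apply/eqP; rewrite eqn_leq rank_leq_row /= -[X in (X < _)%N]rkM.
rewrite ltn_neqAle mxrankS // andbT; apply: contra vM => /eqP eqr.
have := mxrank_leqif_sup (subM v); rewrite eqr => -[_]; rewrite eqxx => /esym.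
by apply: submx_trans; rewrite -addsmxE addsmxSl.
Qed.

Lemma submx_rows d k (M : 'M[R]_(d, k)) (v : 'rV[R]_k) : (v <= M)%MS ->
  exists D : 'rV[R]_d, v = \sum_j D 0 j *: row j M.
Proof.
move=> /submxP[D ->]; exists D.
by rewrite mulmx_sum_row.
Qed.

Lemma dotC k (u v : 'rV[R]_k) : (u *m v^T) 0 0 = (v *m u^T) 0 0.
Proof. by rewrite -[v in RHS]trmxK -trmx_mul [RHS]mxE. Qed.

Lemma dotE k (u v : 'rV[R]_k) : (u *m v^T) 0 0 = \sum_j u 0 j * v 0 j.
Proof. by rewrite mxE; apply: eq_bigr => j _; rewrite mxE. Qed.

Lemma dotDl k (u v w : 'rV[R]_k) :
  ((u + v) *m w^T) 0 0 = (u *m w^T) 0 0 + (v *m w^T) 0 0.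
Proof. by rewrite mulmxDl mxE. Qed.

Lemma dotZl k t (u w : 'rV[R]_k) : ((t *: u) *m w^T) 0 0 = t * (u *m w^T) 0 0.
Proof. by rewrite -scalemxAl mxE. Qed.

Lemma dotBl k (u v w : 'rV[R]_k) :
  ((u - v) *m w^T) 0 0 = (u *m w^T) 0 0 - (v *m w^T) 0 0.
Proof. by rewrite mulmxBl mxE [X in _ + X]mxE. Qed.

Lemma dotBr k (u v w : 'rV[R]_k) :
  (u *m (v - w)^T) 0 0 = (u *m v^T) 0 0 - (u *m w^T) 0 0.
Proof. by rewrite [LHS]dotC dotBl [X in X - _]dotC [X in _ - X]dotC. Qed.

Lemma dot_ge0 k (u : 'rV[R]_k) : 0 <= (u *m u^T) 0 0.
Proof. by rewrite dotE sumr_ge0 // => j _; rewrite -expr2 sqr_ge0. Qed.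

Lemma sqr_coord_le k (u : 'rV[R]_k) i : u 0 i ^+ 2 <= (u *m u^T) 0 0.
Proof.
rewrite dotE (bigD1 i) //= -expr2 lerDl.
by apply: sumr_ge0 => j _; rewrite -expr2 sqr_ge0.
Qed.

Lemma norm_le_sqr (r c : R) : r ^+ 2 <= c -> `|r| <= c + 1.
Proof.
move=> rc; have h1 := sqr_ge0 (r - 1); have h2 := sqr_ge0 (r + 1).
by rewrite ler_norml; apply/andP; split; nra.
Qed.

Lemma coord_le_dist k (u v : 'rV[R]_k) c i : ((u - v) *m (u - v)^T) 0 0 <= c ->
  `|u 0 i| <= \sum_j `|v 0 j| + (c + 1).
Proof.
move=> uvc; have := le_trans (sqr_coord_le (u - v) i) uvc.
rewrite !mxE => /norm_le_sqr uv1.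
rewrite -[u 0 i](subrK (v 0 i)) addrC (le_trans (ler_normD _ _)) // lerD //.
by rewrite (bigD1 i) //= lerDl sumr_ge0.
Qed.

Lemma dot_eq0 k (u : 'rV[R]_k) : (u *m u^T) 0 0 = 0 -> u = 0.
Proof.
rewrite dotE => /eqP; rewrite psumr_eq0 => [/allP u0|j _]; last first.
  by rewrite -expr2 sqr_ge0.
apply/rowP => j; rewrite !mxE.
by have := u0 j; rewrite mem_index_enum mulf_eq0 orbb => /(_ isT) /eqP.
Qed.

Lemma symP d (A : 'M[R]_d) : A \is symmetricmx <-> A^T = A.
Proof.
split=> [/is_hermitianmxP|AT]; first by rewrite expr0 scale1r map_mx_id // => {2}->.
by apply/is_hermitianmxP; rewrite expr0 scale1r map_mx_id.
Qed.

Lemma psd_gram d e (Z : 'M[R]_(e, d)) : psd (Z^T *m Z).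
Proof.
split; first by apply/symP; rewrite trmx_mul trmxK.
by move=> v; rewrite mulmxA -mulmxA -{2}[Z]trmxK -trmx_mul dot_ge0.
Qed.

Lemma psd0 d : psd (0 : 'M[R]_d).
Proof.
by split=> [|v]; [apply/symP; rewrite trmx0|rewrite mulmx0 mul0mx mxE].
Qed.

Lemma psdD d (A B : 'M[R]_d) : psd A -> psd B -> psd (A + B).
Proof.
move=> [/symP As Ap] [/symP Bs Bp]; split.
  by apply/symP; rewrite linearD /= As Bs.
by move=> v; rewrite mulmxDr mulmxDl mxE addr_ge0.
Qed.

Lemma psdZ d (A : 'M[R]_d) (t : R) : 0 <= t -> psd A -> psd (t *: A).
Proof.
move=> t0 [/symP As Ap]; split; first by apply/symP; rewrite linearZ /= As.
by move=> v; rewrite -scalemxAr -scalemxAl mxE mulr_ge0.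
Qed.

Lemma psd_scalar d (t : R) : 0 <= t -> psd (t%:M : 'M[R]_d).
Proof.
move=> t0; rewrite -[t%:M]mulmx1 mul_scalar_mx -[1%:M]mulmx1 -[X in X *m _]trmx1.
exact/psdZ/psd_gram.
Qed.

Lemma affine_ge0_slope (b c : R) : (forall t, 0 <= b * t + c) -> b = 0.
Proof.
move=> h; apply/eqP/negPn/negP => b0.
have := h (- (c + 1) / b); rewrite mulrC divfK // => ?; lra.
Qed.

Lemma quad_block d (a : 'M[R]_1) (b : 'rV[R]_d) (C : 'M[R]_d) t (v : 'rV[R]_d) :
  (row_mx t%:M v *m block_mx a b b^T C *m (row_mx t%:M v)^T) 0 0 =
  t ^+ 2 * a 0 0 + t * ((b *m v^T) 0 0 *+ 2) + (v *m C *m v^T) 0 0.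
Proof.
rewrite mul_row_block tr_row_mx mul_row_col.
have E : (v *m b^T *m t%:M^T) 0 0 = t * (b *m v^T) 0 0.
  by rewrite tr_scalar_mx mul_mx_scalar mxE dotC.
rewrite !mulmxDl mxE [in X in X + _ = _]mxE [in X in _ + X = _]mxE E.
rewrite !mul_scalar_mx -!scalemxAl tr_scalar_mx mul_mx_scalar !mxE; ring.
Qed.

(** Cholesky factorization: a zero pivot forces its row to vanish, and a nonzero
    one is split off, leaving a Schur complement. *)
Lemma psd_factor d (B : 'M[R]_d) : psd B -> exists Z : 'M[R]_d, B = Z^T *m Z.
Proof.
elim: d B => [|d IH] B psdB; first by exists 0; apply/matrixP => -[].
change ('M[R]_(1 + d)) in B; change (exists Z : 'M[R]_(1 + d), B = Z^T *m Z).
have [/symP Bs Bp] := psdB.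
pose a := ulsubmx B; pose b : 'rV[R]_d := ursubmx B; pose C := drsubmx B.
have defB : B = block_mx a b b^T C.
  by rewrite -[LHS]submxK /b trmx_ursub Bs.
have a0 : 0 <= a 0 0.
  have := Bp (row_mx 1%:M 0); rewrite defB quad_block.
  by rewrite trmx0 !mulmx0 (_ : (0 : 'M[R]_1) 0 0 = 0) ?mul0rn ?mulr0 ?addr0 ?expr1n ?mul1r ?mxE.
have Cs : C^T = C by rewrite /C trmx_drsub Bs.
have [a00|an0] := eqVneq (a 0 0) 0.
  have b0 : b = 0.
    apply: dot_eq0; set s := (_ *m _) 0 0.
    suff : s *+ 2 = 0 by move/eqP; rewrite mulrn_eq0 /= => /eqP.
    apply: (@affine_ge0_slope _ ((b *m C *m b^T) 0 0)) => t.
    by have := Bp (row_mx t%:M b); rewrite defB quad_block a00 mulr0 add0r mulrC.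
  have [|Z' CZ] := IH C.
    split; first exact/symP.
    move=> v; have := Bp (row_mx 0%:M v); rewrite defB quad_block.
    by rewrite expr0n !mul0r !add0r.
  exists (block_mx (0 : 'M[R]_1) 0 0 Z').
  rewrite defB tr_block_mx mulmx_block !trmx0 !(mulmx0, mul0mx, add0r, addr0) -CZ.
  by rewrite b0 trmx0 [a]mx11_scalar a00 raddf0.
pose w := Num.sqrt (a 0 0).
have w2 : w ^+ 2 = a 0 0 by rewrite sqr_sqrtr.
have wn0 : w != 0 by apply: contraNneq an0 => w0; rewrite -w2 w0 expr0n.
have [|Z' CZ] := IH (C - (w ^- 2) *: (b^T *m b)).
  split; first by apply/symP; rewrite linearB linearZ /= trmx_mul trmxK Cs.
  move=> v; pose s : R := (b *m v^T) 0 0.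
  have E1 : (v *m (b^T *m b) *m v^T) 0 0 = s ^+ 2.
    rewrite !mulmxA -mulmxA [v *m b^T]mx11_scalar mul_scalar_mx [LHS]mxE.
    by rewrite [X in X * _]dotC expr2.
  have -> : (v *m (C - w ^- 2 *: (b^T *m b)) *m v^T) 0 0 =
            (v *m C *m v^T) 0 0 - w ^- 2 * s ^+ 2.
    rewrite mulmxBr mulmxBl mxE -E1 -scalemxAr -scalemxAl.
    by congr (_ + _); rewrite !mxE.
  (* The minimum over [t] of the quadratic form at [row_mx t%:M v]. *)
  have := Bp (row_mx (- s / w ^+ 2)%:M v); rewrite defB quad_block -w2 -/s => H.
  rewrite (le_trans H) // le_eqVlt; apply/orP; left; apply/eqP.
  by field.
exists (block_mx w%:M (w^-1 *: b) 0 Z').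
rewrite defB tr_block_mx mulmx_block !trmx0 !(mulmx0, mul0mx, add0r, addr0) -CZ.
rewrite tr_scalar_mx [(w^-1 *: b)^T]linearZ /=; congr block_mx.
- by rewrite -scalar_mxM -expr2 w2 -mx11_scalar.
- by rewrite mul_scalar_mx scalerA divff // scale1r.
- by rewrite mul_mx_scalar scalerA divff // scale1r.
- by rewrite -scalemxAl -scalemxAr scalerA -expr2 exprVn addrC subrK.
Qed.

Lemma psd_iso d (A : 'M[R]_d) (v : 'rV[R]_d) :
  psd A -> (v *m A *m v^T) 0 0 = 0 -> v *m A = 0.
Proof.
move=> /psd_factor[Z ->]; rewrite mulmxA -mulmxA => vv0.
suff -> : v *m Z^T = 0 by rewrite mul0mx.
by apply: dot_eq0; rewrite trmx_mul trmxK.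
Qed.

Lemma mxtrace_gram_quad d e (A : 'M[R]_d) (Z : 'M[R]_(e, d)) :
  \tr (A *m (Z^T *m Z)) = \sum_l (row l Z *m A *m (row l Z)^T) 0 0.
Proof.
rewrite mulmxA mxtrace_mulC mulmxA /mxtrace; apply: eq_bigr => l _.
by rewrite -row_mul [RHS]mxE [LHS]mxE; apply: eq_bigr => j _; rewrite !mxE.
Qed.

Lemma mxtrace_psd_ge0 d (A B : 'M[R]_d) : psd A -> psd B -> 0 <= \tr (A *m B).
Proof.
move=> [_ Ap] /psd_factor[Z ->]; rewrite mxtrace_gram_quad.
by apply: sumr_ge0.
Qed.

Lemma mxtrace_psd_eq0 d (A B : 'M[R]_d) : psd A -> psd B -> \tr (A *m B) = 0 ->
  B *m A = 0.
Proof.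
move=> psdA /psd_factor[Z ->]; rewrite mxtrace_gram_quad => /eqP.
rewrite psumr_eq0 => [/allP z0|l _]; last by case: psdA.
rewrite -mulmxA; suff -> : Z *m A = 0 by rewrite mulmx0.
apply/row_matrixP => l; rewrite row_mul row0 (psd_iso psdA) //.
by apply/eqP/z0; rewrite mem_index_enum.
Qed.

Lemma psd_diag_ge0 d (A : 'M[R]_d) j : psd A -> 0 <= A j j.
Proof.
move=> [_ /(_ (delta_mx 0 j))]; rewrite -rowE trmx_delta -colE.
by rewrite !mxE.
Qed.

Lemma psd_entry_le d (A : 'M[R]_d) j k : psd A -> `|A j k| *+ 2 <= A j j + A k k.
Proof.
move=> [/symP As Ap].
have quad (t : R) : 0 <= A j j + t * A j k *+ 2 + t ^+ 2 * A k k.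
  have := Ap (delta_mx 0 j + t *: delta_mx 0 k).
  rewrite linearD linearZ /= !trmx_delta mulmxDl -scalemxAl -!rowE.
  rewrite mulmxDl !mulmxDr -!scalemxAr -!scalemxAl -!colE !mxE.
  have -> : A k j = A j k by rewrite -[in LHS]As mxE.
  congr (_ <= _); ring.
have := quad 1; have := quad (- 1); rewrite sqrrN expr1n !mul1r mulN1r mulr2n.
case: (ger0P (A j k)) => _; lra.
Qed.

Lemma psd_sum d k (A : 'I_k -> 'M[R]_d) : (forall i, psd (A i)) -> psd (\sum_i A i).
Proof.
by move=> Ap; elim/big_ind: _ => [|B C|i _]; [exact: psd0|exact: psdD|exact: Ap].
Qed.

(** The quadratic forms of symmetric [A k] are unchanged by compression with [Q],
    while no nonzero [B] supported on the range of [Q] is annihilated by all of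
    them.  [Q] projects onto a complement of the common kernel, along it. *)
Lemma support_projector d q (A : 'I_q -> 'M[R]_d) : exists Q : 'M[R]_d,
  [/\ Q *m Q = Q, forall k, Q *m A k = A k
    & forall B : 'M[R]_d, (forall k, B *m A k = 0) -> B *m Q = 0].
Proof.
pose N := (\bigcap_k kermx (A k))%MS.
have cap0 : (N^C :&: N = 0)%MS by rewrite capmxC capmx_compl.
exists (proj_mx N^C%MS N); split.
- exact: proj_mx_proj.
- move=> k; apply/eqP; rewrite eq_sym -subr_eq0 -[X in X - _]mul1mx -mulmxBl.
  have : (1%:M - 1%:M *m proj_mx N^C%MS N <= N)%MS.
    apply: proj_mx_compl_sub; rewrite addsmxC; apply: submx_full.
    exact: addsmx_compl_full.
  rewrite mul1mx => /sub_bigcapmxP /(_ k isT) /sub_kermxP ->.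
  exact: eqxx.
- move=> B BA; apply: proj_mx_0 => //.
  by apply/sub_bigcapmxP => k _; apply/sub_kermxP.
Qed.

Lemma affine_map_comb (V W : lmodType R) (f : V -> W) k (t : 'I_k -> R) (p : 'I_k -> V) :
  affine_map f -> \sum_i t i = 1 -> f (\sum_i t i *: p i) = \sum_i t i *: f (p i).
Proof.
move=> [L [b fE]] t1; rewrite fE linear_sum -[b]scale1r -t1 scaler_suml -big_split.
by apply: eq_bigr => i _; rewrite fE linearZ scalerDr.
Qed.

(** Turns a proof of linearity obtained inside another proof into a structure. *)
Definition linear_pack (V W : lmodType R) (f : V -> W) (lf : linear f) : {linear V -> W} :=
  HB.pack f (GRing.isLinear.Build _ _ _ _ _ lf).

Definition pack (J : finType) (w : J -> R) : 'rV[R]_#|J| := \row_j w (enum_val j).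

Lemma packE (J : finType) (w : J -> R) j : pack w 0 (enum_rank j) = w j.
Proof. by rewrite mxE enum_rankK. Qed.

End LinearAlgebra.

(** * Closed convex sets and nearest points *)

Section ConvexGeometry.
Variable R : realType.

Definition conv_closed (V : lmodType R) (P : set V) : Prop :=
  forall (t : R) x y, 0 <= t <= 1 -> P x -> P y -> P ((1 - t) *: x + t *: y).

Lemma linear_coord_continuous m a b (L : {linear 'rV[R]_m -> 'M[R]_(a, b)}) i j :
  continuous (fun p => L p i j).
Proof.
have -> : (fun p => L p i j) = (fun p => \sum_k p 0 k * L (delta_mx 0 k) i j).
  apply/funext => p; rewrite {1}[p]row_sum_delta linear_sum summxE.
  by apply: eq_bigr => k _; rewrite linearZ mxE.
apply: continuous_big => [|k _] p; first exact: add_continuous.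
by apply: continuousM; [exact: coord_continuous|exact: cst_continuous].
Qed.

Lemma closed_ge0 (T : topologicalType) (g : T -> R) :
  continuous g -> closed [set x | 0 <= g x].
Proof.
by move=> /continuous_closedP /(_ _ (@closed_ge R 0)).
Qed.

Lemma closed_eq0 (T : topologicalType) (g : T -> R) :
  continuous g -> closed [set x | g x = 0].
Proof.
by move=> /continuous_closedP /(_ _ (@closed_eq R 0)).
Qed.

Lemma closed_forall (T : topologicalType) (I : Type) (F : I -> set T) :
  (forall i, closed (F i)) -> closed [set x | forall i, F i x].
Proof.
move=> Fcl; have -> : [set x | forall i, F i x] = \bigcap_i F i.
  by apply/seteqP; split=> x h i //; exact: h.
exact: closed_bigI.
Qed.

Lemma closure_sub (T : topologicalType) (A B : set T) :
  closed B -> A `<=` B -> closure A `<=` B.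
Proof. by move=> /closure_id cB AB; rewrite [B]cB; exact: closureS. Qed.

Lemma psd_preimage_closed m d (L : {linear 'rV[R]_m -> 'M[R]_d}) :
  closed [set v | psd (L v)].
Proof.
have -> : [set v | psd (L v)] =
    [set v | forall ij : 'I_d * 'I_d, L v ij.1 ij.2 - L v ij.2 ij.1 = 0] `&`
    [set v | forall w : 'rV_d, 0 <= (w *m L v *m w^T) 0 0].
  apply/seteqP; split=> v.
    move=> [/symP Ls Lp]; split=> // -[i j] /=.
    by rewrite -[in X in _ - X]Ls mxE subrr.
  move=> [/= Ls Lp]; split=> //; apply/symP/matrixP => i j; rewrite mxE.
  by apply/eqP; rewrite -subr_eq0; apply/eqP; exact: (Ls (j, i)).
apply: closedI; apply: closed_forall.
  move=> [i j] /=; apply: closed_eq0 => v; apply: continuousB;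
  exact: linear_coord_continuous.
move=> w; apply: closed_ge0.
exact: (@linear_coord_continuous m 1 1 (mulmxr w^T \o mulmx w \o L) 0 0).
Qed.

Lemma affine_form_continuous m n (L : {linear 'rV[R]_m -> 'rV[R]_n}) a (b : 'rV[R]_n) :
  continuous (fun p => a + (L p *m b^T) 0 0).
Proof.
move=> p; apply: continuousD; first exact: cst_continuous.
have /= := @linear_coord_continuous m 1 1 (mulmxr b^T \o L) 0 0 p.
exact.
Qed.

Lemma sq_dist_continuous m n (L : {linear 'rV[R]_m -> 'rV[R]_n}) (f : 'rV[R]_n) :
  continuous (fun p => ((L p - f) *m (L p - f)^T) 0 0).
Proof.
have -> : (fun p => ((L p - f) *m (L p - f)^T) 0 0) =
          (fun p => \sum_k (L p 0 k - f 0 k) ^+ 2).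
  by apply/funext => p; rewrite dotE; apply: eq_bigr => k _; rewrite !mxE expr2.
apply: continuous_big => [|k _] p; first exact: add_continuous.
pose g (q : 'rV[R]_m) : R := L q 0 k - f 0 k.
have h : {for p, continuous g}.
  apply: continuousB; first exact: linear_coord_continuous.
  exact: cst_continuous.
exact: (continuousM h h).
Qed.

(** Only the sublevel set of [p0] has to be bounded: the minimum over its
    compact part of [P] is a minimum over all of [P]. *)
Lemma closed_min_attained m (P : set 'rV[R]_m) (h : 'rV[R]_m -> R) p0 (C : R) :
  closed P -> continuous h -> P p0 ->
  (forall p, P p -> h p <= h p0 -> forall i, `|p 0 i| <= C) ->
  exists p, P p /\ forall q, P q -> h p <= h q.
Proof.
move=> Pcl hc Pp0 bnd.
pose B := [set v : 'rV[R]_m | forall i, `[- C, C]%classic (v ord0 i)].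
have Bcpt : compact B.
  by apply: (@rV_compact R m (fun=> `[- C, C]%classic)) => i; exact: segment_compact.
have D0 : (P `&` B) !=set0.
  exists p0; split=> // i.
  by rewrite /= in_itv /= -ler_norml; exact: bnd.
have Dcpt : compact (P `&` B).
  rewrite setIC; apply: compact_closedI => //.
have hD : {within P `&` B, continuous h} by exact: continuous_subspaceT.
have [p /set_mem[Pp _] pmin] := EVT_min_rV D0 Dcpt hD.
have pp0 : h p <= h p0.
  by apply: pmin; apply/mem_set; split=> // i; rewrite /= in_itv /= -ler_norml; exact: bnd.
exists p; split=> // q Pq; have [qp0|/ltW qp0] := leP (h q) (h p0).
  apply: pmin; apply/mem_set; split=> // i.
  by rewrite /= in_itv /= -ler_norml; exact: bnd.
exact: le_trans pp0 qp0.
Qed.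

Lemma sqn_line n (u v : 'rV[R]_n) t :
  ((u + t *: v) *m (u + t *: v)^T) 0 0 =
  (u *m u^T) 0 0 + t * ((u *m v^T) 0 0 *+ 2) + t ^+ 2 * (v *m v^T) 0 0.
Proof.
rewrite !dotE mulrnAr -mulrnAl !big_distrr -!big_split /=; apply: eq_bigr => j _.
rewrite !mxE; ring.
Qed.

(** First-order condition at the left end of a segment. *)
Lemma quad_ge0_slope (a b : R) :
  (forall t, 0 <= t <= 1 -> 0 <= t * a + t ^+ 2 * b) -> 0 <= a.
Proof.
move=> h; rewrite leNgt; apply/negP => a0.
(* This [t] is so small that the linear term dominates. *)
have c0 : 0 < `|b| + 1 - a by have := normr_ge0 b; lra.
pose t := - a / (`|b| + 1 - a).
have t0 : 0 < t by rewrite divr_gt0 // oppr_gt0.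
have t1 : t <= 1 by rewrite ler_pdivrMr // mul1r; have := normr_ge0 b; lra.
have := h t; rewrite (ltW t0) t1 => /(_ isT).
rewrite expr2 -mulrA -mulrDr pmulr_rge0 //.
have : t * b <= t * `|b| by rewrite ler_wpM2l ?(ltW t0) ?ler_norm.
have : t * (`|b| + 1 - a) = - a by rewrite /t divfK // gt_eqF.
have : t * a < 0 by rewrite pmulr_rlt0.
by move: t0; nra.
Qed.

Section NearestPoint.
Variables (m n : nat) (P : set 'rV[R]_m) (L : {linear 'rV[R]_m -> 'rV[R]_n}).
Variable f : 'rV[R]_n.
Hypothesis bnd : forall c, exists C : R, forall p, P p ->
  ((L p - f) *m (L p - f)^T) 0 0 <= c -> forall i, `|p 0 i| <= C.

(** The point of [L @` P] nearest to [f] exists since its preimages stay in a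
    bounded set; the inequality is the first-order condition for its
    minimality along segments of [P]. *)
Lemma nearest_image_point : closed P -> conv_closed P -> P !=set0 ->
  exists p, P p /\ forall q, P q -> 0 <= ((L p - f) *m (L q - L p)^T) 0 0.
Proof.
move=> Pcl Pcv [p0 Pp0].
have [C bC] := bnd (((L p0 - f) *m (L p0 - f)^T) 0 0).
have [p [Pp pmin]] := closed_min_attained Pcl (@sq_dist_continuous _ _ L f) Pp0 bC.
exists p; split=> // q Pq.
suff : 0 <= ((L p - f) *m (L q - L p)^T) 0 0 *+ 2 by rewrite pmulrn_lge0.
apply: (@quad_ge0_slope _ (((L q - L p) *m (L q - L p)^T) 0 0)) => t t01.
have := pmin _ (Pcv t _ _ t01 Pp Pq).
have -> : L ((1 - t) *: p + t *: q) - f = (L p - f) + t *: (L q - L p).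
  by rewrite linearD !linearZ /=; apply/rowP => j; rewrite !mxE; ring.
by rewrite sqn_line -addrA lerDl.
Qed.

(** By the first-order condition the half-space of the [y] with
    [0 <= (L p - f) . (y - L p)] contains the image, hence [f], which forces
    [L p = f]. *)
Lemma closed_image_mem : closed P -> conv_closed P ->
  closure (L @` P) f -> (L @` P) f.
Proof.
move=> Pcl Pcv clf.
have P0 : P !=set0.
  have [|_ [[p Pp _] _]] := clf setT; first exact: filterT.
  by exists p.
have [p [Pp pmin]] := nearest_image_point Pcl Pcv P0.
exists p => //; apply/eqP; rewrite -subr_eq0; apply/eqP/dot_eq0.
apply/eqP; rewrite eq_le dot_ge0 andbT.
pose g (y : 'rV[R]_n) : R := - ((L p - f) *m (L p)^T) 0 0 + (y *m (L p - f)^T) 0 0.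
have cg : continuous g.
  by have := @affine_form_continuous n n idfun (- ((L p - f) *m (L p)^T) 0 0) (L p - f).
have : 0 <= g f.
  apply: (closure_sub (closed_ge0 cg) _ clf) => _ [q Pq <-] /=.
  by have := pmin _ Pq; rewrite /g dotBr [X in X - _]dotC addrC.
suff -> : g f = - ((L p - f) *m (L p - f)^T) 0 0 by rewrite oppr_ge0.
by rewrite [in RHS]dotBr opprB /g addrC [X in X - _]dotC.
Qed.

End NearestPoint.

Lemma conv_closed_closure n (K : set 'rV[R]_n) :
  conv_closed K -> conv_closed (closure K).
Proof.
move=> Kcv t x y t01 Kx Ky.
have cmul (s : R) (b : 'rV[R]_n) : continuous (fun z : 'rV[R]_n => s *: z + b).
  move=> z; apply: continuousD; last exact: cst_continuous.
  exact: scaler_continuous.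
have pre (s : R) (b : 'rV[R]_n) : closed [set z | closure K (s *: z + b)].
  by have /continuous_closedP := cmul s b; apply; exact: closed_closure.
have step1 z : K z -> closure K ((1 - t) *: x + t *: z).
  move=> Kz; apply: (closure_sub (pre _ _) _ Kx) => w Kw /=.
  exact/subset_closure/Kcv.
rewrite addrC; apply: (closure_sub (pre _ _) _ Ky) => w Kw /=.
by rewrite addrC; exact: step1.
Qed.

(** The nearest point to [x] in the closure of [K] gives an affine function that
    is nonnegative on [K] and negative at [x], unless [x] is that point.  If [K]
    is empty, the constant [-1] does it. *)
Lemma separation_closure n (K : set 'rV[R]_n) x : conv_closed K ->
  (forall a (b : 'rV[R]_n), (forall y, K y -> 0 <= a + (y *m b^T) 0 0) ->
     0 <= a + (x *m b^T) 0 0) ->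
  closure K x.
Proof.
move=> Kcv hx.
have [[y0 Ky0]|K0] := pselect (K !=set0); last first.
  have := hx (-1) 0; rewrite trmx0 mulmx0 mxE addr0 => h.
  suff : 0 <= (-1 : R) by lra.
  by apply: h => y Ky; case: K0; exists y.
have [||||p [Kp pmin]] := @nearest_image_point n n (closure K) idfun x.
- by move=> c; exists (\sum_j `|x 0 j| + (c + 1)) => p _ /= hp i; exact: coord_le_dist.
- exact: closed_closure.
- exact: conv_closed_closure.
- by exists y0; exact: subset_closure.
suff -> : x = p by [].
apply/esym/eqP; rewrite -subr_eq0; apply/eqP/dot_eq0/eqP.
rewrite eq_le dot_ge0 andbT -oppr_ge0.
have := hx (- (p *m (p - x)^T) 0 0) (p - x).
have -> : - (p *m (p - x)^T) 0 0 + (x *m (p - x)^T) 0 0 = - ((p - x) *m (p - x)^T) 0 0.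
  by rewrite [in RHS]dotBl opprB addrC.
apply=> y Ky; have := pmin _ (subset_closure Ky).
by rewrite /= dotC dotBl [X in _ -> 0 <= X]addrC.
Qed.

(** [e] is the minimum of the squared length of the image on the part of the
    unit sphere in [P], which is positive by the hypothesis on [L]; if this part
    is empty, then [P] has no nonzero element. *)
Lemma cone_image_coercive m n (P : set 'rV[R]_m) (L : {linear 'rV[R]_m -> 'rV[R]_n}) :
  closed P -> (forall (t : R) p, 0 <= t -> P p -> P (t *: p)) ->
  (forall p, P p -> L p = 0 -> p = 0) ->
  exists2 e : R, 0 < e & forall p, P p ->
    e * (p *m p^T) 0 0 <= (L p *m (L p)^T) 0 0.
Proof.
move=> Pcl Pcone Linj.
have dot00 k : ((0 : 'rV[R]_k) *m (0 : 'rV[R]_k)^T) 0 0 = 0 by rewrite mul0mx mxE.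
have sqcont k (M : {linear 'rV[R]_m -> 'rV[R]_k}) :
    continuous (fun p => (M p *m (M p)^T) 0 0).
  have -> : (fun p => (M p *m (M p)^T) 0 0) =
            (fun p => ((M p - 0) *m (M p - 0)^T) 0 0).
    by apply/funext => p; rewrite subr0.
  exact: sq_dist_continuous.
pose D := P `&` [set p : 'rV[R]_m | (p *m p^T) 0 0 = 1].
have Dcl : closed D.
  apply: closedI => //.
  have /continuous_closedP /(_ _ (@closed_eq R 1)) := sqcont m idfun.
  exact.
have sq1 p i : D p -> `|p 0 i| <= 1.
  move=> [_ /= p1].
  have : p 0 i ^+ 2 <= 1 by rewrite -p1 sqr_coord_le.
  by rewrite -{1}(expr1n R 2) -real_normK ?num_real // ler_pXn2r // nnegrE.
have normalize p : P p -> p != 0 -> D ((Num.sqrt ((p *m p^T) 0 0))^-1 *: p).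
  move=> Pp pn0; have pp0 : 0 < (p *m p^T) 0 0.
    rewrite lt_neqAle dot_ge0 andbT eq_sym.
    by apply: contra pn0 => /eqP/dot_eq0/eqP.
  split; first by apply: Pcone => //; rewrite invr_ge0 sqrtr_ge0.
  rewrite /= linearZ -scalemxAl -scalemxAr scalerA mxE -expr2 exprVn sqr_sqrtr ?ltW //.
  by rewrite mulVf // gt_eqF.
have [[p0 Dp0]|D0] := pselect (D !=set0); last first.
  exists 1 => // p Pp; have [->|pn0] := eqVneq p 0.
    by rewrite [L 0]linear0 !dot00 mulr0.
  by case: D0; eexists; exact: normalize pn0.
have [|p [[Pp p1] pmin]] := @closed_min_attained _ D _ p0 1 Dcl (sqcont _ L) Dp0.
  by move=> p Dp _ i; exact: sq1.
exists ((L p *m (L p)^T) 0 0) => [|q Pq].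
  rewrite lt_neqAle dot_ge0 andbT eq_sym; apply/negP => /eqP/dot_eq0 /(Linj _ Pp) pz.
  by move: p1; rewrite /= pz mul0mx mxE => /eqP; rewrite eq_sym oner_eq0.
have [->|qn0] := eqVneq q 0.
  by rewrite [L 0]linear0 !dot00 mulr0.
have [_ q1] := normalize _ Pq qn0.
have := pmin _ (normalize _ Pq qn0).
set s := Num.sqrt _ in q1 *.
rewrite [L (_ *: q)]linearZ /= [(_ *: L q)^T]linearZ /= -scalemxAl -scalemxAr scalerA [X in _ <= X -> _]mxE.
have s0 : s != 0.
  by apply: contraPneq q1 => s0 /=; rewrite s0 invr0 scale0r mul0mx mxE => /eqP;
     rewrite eq_sym oner_eq0.
have ss : s * s = (q *m q^T) 0 0 by rewrite -expr2 sqr_sqrtr // dot_ge0.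
have sp : 0 < s by rewrite lt_neqAle eq_sym s0 sqrtr_ge0.
by rewrite -ss -invfM [X in _ <= X -> _]mulrC ler_pdivlMr ?mulr_gt0.
Qed.

End ConvexGeometry.

(** * Trace duality on a spectrahedron *)

Section Duality.
Variable R : realType.

(** As [L] kills no nonzero element of [P], it is coercive on [P], so there is a
    nearest point [L p] to [f]; if it differs from [f], then [z := L p - f]
    separates. *)
Lemma farkas_closed_cone m n (P : set 'rV[R]_m) (L : {linear 'rV[R]_m -> 'rV[R]_n})
    (f : 'rV[R]_n) :
  closed P -> P 0 -> (forall (t : R) p, 0 <= t -> P p -> P (t *: p)) ->
  (forall p q, P p -> P q -> P (p + q)) ->
  (forall p, P p -> L p = 0 -> p = 0) ->
  (exists2 p, P p & L p = f) \/
  exists z : 'rV[R]_n, (forall q, P q -> 0 <= (z *m (L q)^T) 0 0) /\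
    (z *m f^T) 0 0 < 0.
Proof.
move=> Pcl P0 Pscale Padd Linj.
have [e e0 eP] := cone_image_coercive Pcl Pscale Linj.
have [||||p [Pp pmin]] := @nearest_image_point R m n P L f.
- move=> c; exists ((2 * c + 2 * (f *m f^T) 0 0) / e + 1) => p Pp pc i.
  apply: norm_le_sqr; rewrite ler_pdivlMr // mulrC.
  apply: (@le_trans _ _ (e * (p *m p^T) 0 0)).
    by rewrite ler_pM2l // sqr_coord_le.
  apply: (le_trans (eP _ Pp)).
  apply: (@le_trans _ _ (2 * ((L p - f) *m (L p - f)^T) 0 0 + 2 * (f *m f^T) 0 0)).
    rewrite !dotE !big_distrr -big_split /=; apply: ler_sum => j _; rewrite !mxE.
    set a : R := L p 0 j; set b : R := f 0 j.
    have := sqr_ge0 (a - 2 * b); nra.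
  by rewrite lerD2r ler_pM2l.
- exact: Pcl.
- move=> t x y /andP[t0 t1] Px Py; apply: Padd; apply: Pscale => //.
  by rewrite subr_ge0.
- by exists 0.
have ortho : ((L p - f) *m (L p)^T) 0 0 = 0.
  apply/eqP; rewrite eq_le; apply/andP; split.
    by have := pmin _ P0; rewrite dotBr [L 0]linear0 trmx0 mulmx0 [X in X - _]mxE sub0r oppr_ge0.
  have := pmin _ (Padd _ _ Pp Pp).
  by rewrite [L (p + p)]linearD addrK.
have pos q : P q -> 0 <= ((L p - f) *m (L q)^T) 0 0.
  by move=> /pmin; rewrite dotBr ortho subr0.
have [/eqP|zn0] := eqVneq (L p - f) 0.
  by rewrite subr_eq0 => /eqP; left; exists p.
right; exists (L p - f); split=> //.
have : ((L p - f) *m (L p - f)^T) 0 0 != 0 by apply: contraNneq zn0 => /dot_eq0 ->.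
have := dot_ge0 (L p - f); rewrite le_eqVlt eq_sym => /orP[-> //|].
by rewrite dotBr ortho sub0r oppr_gt0.
Qed.

(** Affine combinations of points [x] are linear combinations of the vectors
    [(1, x)]. *)
Lemma affine_spanning s (S : set 'rV[R]_s) : S !=set0 ->
  exists p : 'I_s.+1 -> 'rV[R]_s, (forall k, S (p k)) /\
    forall x, S x -> exists t : 'I_s.+1 -> R,
      \sum_k t k = 1 /\ x = \sum_k t k *: p k.
Proof.
move=> [x0 Sx0].
pose Y : set 'rV[R]_(1 + s) := [set row_mx 1%:M x | x in S].
have [||M [MY spM]] := @spanning_rows R (1 + s) s.+1 Y; first by exists (row_mx 1%:M x0), x0.
  by rewrite add1n.
have rowM k : row k M = row_mx 1%:M (rsubmx (row k M)).
  by have [x Sx <-] := MY k; rewrite row_mxKr.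
exists (fun k => rsubmx (row k M)); split=> [k|x Sx].
  by have [x Sx <-] := MY k; rewrite row_mxKr.
have [|D xE] := submx_rows (spM (row_mx 1%:M x) _); first by exists x.
exists (fun k => D 0 k); split.
  have /(congr1 (fun v : 'rV_(1 + s) => lsubmx v 0 0)) := xE.
  rewrite row_mxKl [X in X = _ -> _]mxE eqxx => /esym e1; apply: etrans e1.
  rewrite linear_sum summxE.
  apply: eq_bigr => k _; rewrite linearZ /= rowM row_mxKl.
  by rewrite !mxE eqxx mulr1.
have /(congr1 (fun v : 'rV_(1 + s) => rsubmx v)) := xE.
rewrite row_mxKr => ->; rewrite linear_sum.
by apply: eq_bigr => k _; rewrite linearZ.
Qed.

Section TraceDuality.
Variables (m d s : nat) (phi : 'rV[R]_s -> {ffun 'I_m -> 'M[R]_d}).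
Hypothesis phi_affine : affine_map phi.
Hypothesis phi_sym : forall x i, phi x i \is symmetricmx.

Let S : set 'rV[R]_s := [set x | forall i, psd (phi x i)].

Lemma phi_comb k (t : 'I_k -> R) (p : 'I_k -> 'rV[R]_s) i :
  \sum_l t l = 1 -> phi (\sum_l t l *: p l) i = \sum_l t l *: phi (p l) i.
Proof.
move=> /(affine_map_comb p phi_affine) ->; rewrite sum_ffunE.
by apply: eq_bigr => l _; rewrite ffunE.
Qed.

Lemma affine_form_comb (a : R) (b : 'rV[R]_s) k (t : 'I_k -> R) (p : 'I_k -> 'rV[R]_s) :
  \sum_l t l = 1 -> a + ((\sum_l t l *: p l) *m b^T) 0 0 =
    \sum_l t l * (a + (p l *m b^T) 0 0).
Proof.
move=> t1; rewrite mulmx_suml summxE -[X in X + _ = _]mul1r -t1 mulr_suml -big_split /=.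
by apply: eq_bigr => l _; rewrite -scalemxAl [X in _ + X = _]mxE mulrDr.
Qed.

(** If the total mass of the weights [z] is positive, the inequality is the one
    at their barycentre, which lies in [S] because [phi] commutes with affine
    combinations.  A vanishing total mass is made positive by adding a little
    mass at the point [p 0] of [S]. *)
Lemma barycentre_ge0 q (p : 'I_q.+1 -> 'rV[R]_s) (z : 'I_q.+1 -> R) a (b : 'rV[R]_s) :
  (forall x, S x -> 0 <= a + (x *m b^T) 0 0) -> (forall k, S (p k)) ->
  0 <= \sum_k z k ->
  (forall i (w : 'rV[R]_d), 0 <= \sum_k z k * (w *m phi (p k) i *m w^T) 0 0) ->
  0 <= \sum_k z k * (a + (p k *m b^T) 0 0).
Proof.
move=> g_ge0 Sp zsum zpsd; pose g (x : 'rV[R]_s) : R := a + (x *m b^T) 0 0.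
rewrite leNgt; apply/negP => zneg; set Z := (X in X < 0) in zneg.
have g0 : 0 <= g (p 0) by apply: g_ge0.
(* The mass is chosen so that [Z + e * g (p 0)] remains negative. *)
pose e := - Z / (1 + g (p 0)).
have e0 : 0 < e by rewrite divr_gt0 ?oppr_gt0 // ltr_pwDl.
pose y k := z k + (k == 0)%:R * e.
have ysum (h : 'I_q.+1 -> R) : \sum_k y k * h k = \sum_k z k * h k + e * h 0.
  under eq_bigr do rewrite mulrDl.
  rewrite big_split /=; congr (_ + _); rewrite (bigD1 0) //= mul1r big1 ?addr0 // => k /negbTE ->.
  by rewrite !mul0r.
pose T := \sum_k y k.
have T0 : 0 < T.
  have := ysum (fun=> 1); under eq_bigr do rewrite mulr1.
  rewrite -/T => ->; rewrite mulr1; under eq_bigr do rewrite mulr1.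
  by rewrite ltr_wpDl.
pose t k := y k / T.
have t1 : \sum_k t k = 1 by rewrite -mulr_suml divff // gt_eqF.
have tsum (h : 'I_q.+1 -> R) : \sum_k t k * h k = T^-1 * (\sum_k z k * h k + e * h 0).
  by rewrite -ysum mulr_sumr; apply: eq_bigr => k _; rewrite /t mulrAC mulrC.
pose x := \sum_k t k *: p k.
have Sx : S x.
  move=> i; split; first exact: phi_sym.
  move=> w; rewrite phi_comb // mulmx_sumr mulmx_suml summxE.
  have -> : \sum_k (w *m (t k *: phi (p k) i) *m w^T) 0 0 =
            \sum_k t k * (w *m phi (p k) i *m w^T) 0 0.
    by apply: eq_bigr => k _; rewrite -scalemxAr -scalemxAl mxE.
  rewrite tsum mulr_ge0 ?invr_ge0 ?(ltW T0) // addr_ge0 // mulr_ge0 ?(ltW e0) //.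
  by have [_] := Sp 0 i.
have := g_ge0 _ Sx; rewrite affine_form_comb // (tsum (fun k => g (p k))) -/Z.
rewrite pmulr_rge0 ?invr_gt0 // leNgt => /negP; apply.
have : e * (1 + g (p 0)) = - Z by rewrite /e divfK // gt_eqF // ltr_pwDl.
move: e0; move: (e) (Z) (g (p 0)) => e' z' g'; lra.
Qed.

(** Strong duality on [S], without a strictly feasible point.  Both sides are
    compared at points [p k] that affinely span [S], and the [B i] range over
    matrices compressed by the support projectors [Q i].  This makes the cone
    of right-hand sides closed, so that [farkas_closed_cone] applies; the
    alternative [z] that it leaves contradicts [barycentre_ge0]. *)
Theorem trace_duality (a : R) (b : 'rV[R]_s) :
  (forall x, S x -> 0 <= a + (x *m b^T) 0 0) ->
  exists (c : R) (B : 'I_m -> 'M[R]_d), [/\ 0 <= c, forall i, psd (B i)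
    & forall x, S x -> a + (x *m b^T) 0 0 = c + \sum_i \tr (phi x i *m B i)].
Proof.
pose g (x : 'rV[R]_s) : R := a + (x *m b^T) 0 0.
rewrite -/g => g_ge0.
have [S0|S0] := pselect (S !=set0); last first.
  exists 0, (fun=> 0); split=> // [i|x Sx]; first exact: psd0.
  by case: S0; exists x.
have [p [Sp spanS]] := affine_spanning S0.
have psdp k i : psd (phi (p k) i) by exact: Sp.
have supp i := cid (support_projector (fun k => phi (p k) i)).
pose Q i := sval (supp i).
have Qprop i : [/\ Q i *m Q i = Q i, forall k, Q i *m phi (p k) i = phi (p k) i
  & forall B : 'M[R]_d, (forall k, B *m phi (p k) i = 0) -> B *m Q i = 0].
  exact: svalP (supp i).
(* Coordinates for the tuples [(c, B)]. *)
pose J : finType := option ('I_m * ('I_d * 'I_d)).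
pose cst_part (v : 'rV[R]_#|J|) : R := v 0 (enum_rank (None : J)).
have [mat matE] : exists mat : 'I_m -> {linear 'rV[R]_#|J| -> 'M[R]_d},
    forall i v j k, mat i v j k = v 0 (enum_rank (Some (i, (j, k)) : J)).
  have mat_lin i : linear (fun v : 'rV[R]_#|J| =>
      \matrix_(j, k) v 0 (enum_rank (Some (i, (j, k)) : J)) : 'M[R]_d).
    by move=> t u v; apply/matrixP => j k; rewrite !mxE.
  by exists (fun i => linear_pack (mat_lin i)) => i v j k; rewrite mxE.
have [L LE] : exists L : {linear 'rV[R]_#|J| -> 'rV[R]_s.+1},
    forall v k, L v 0 k = cst_part v + \sum_i \tr (phi (p k) i *m mat i v).
  have L_lin : linear (fun v : 'rV[R]_#|J| =>
      \row_(k < s.+1) (cst_part v + \sum_i \tr (phi (p k) i *m mat i v))).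
    move=> t u v; apply/rowP => k; rewrite !mxE /cst_part !mxE mulrDr addrACA.
    congr (_ + _); rewrite mulr_sumr -big_split /=; apply: eq_bigr => i _.
    by rewrite linearP mulmxDr linearD -scalemxAr linearZ.
  by exists (linear_pack L_lin) => v k; rewrite mxE.
pose P : set 'rV[R]_#|J| := [set v | 0 <= cst_part v] `&`
  [set v | forall i, psd (mat i v) /\ (Q i)^T *m mat i v *m Q i = mat i v].
have mk (c : R) (B : 'I_m -> 'M[R]_d) : exists v : 'rV[R]_#|J|,
    cst_part v = c /\ forall i, mat i v = B i.
  exists (pack (fun j : J => if j is Some (i, (k, l)) then B i k l else c)).
  split; first by rewrite /cst_part packE.
  by move=> i; apply/matrixP => k l; rewrite matE packE.
have Pcl : closed P.
  apply: closedI.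
    by apply: closed_ge0 => v; exact: coord_continuous.
  apply: closed_forall => i; apply: closedI; first exact: psd_preimage_closed.
  rewrite (_ : (fun v => _) = [set v | forall jk : 'I_d * 'I_d,
      ((Q i)^T *m mat i v *m Q i) jk.1 jk.2 - mat i v jk.1 jk.2 = 0]); last first.
    apply/seteqP; split=> v /= h; first by move=> jk; rewrite h subrr.
    by apply/matrixP => j k; apply/eqP; rewrite -subr_eq0; apply/eqP; exact: (h (j, k)).
  apply: closed_forall => -[j k] /=; apply: closed_eq0 => v; apply: continuousB.
    exact: (@linear_coord_continuous R _ d d (mulmxr (Q i) \o mulmx (Q i)^T \o mat i) j k).
  exact: linear_coord_continuous.
have [||||[v [cv Pv] Lv]|[z [zpos zneg]]] :=
  @farkas_closed_cone _ _ P L (\row_k g (p k)) Pcl.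
- split; first by rewrite /= /cst_part mxE.
  by move=> i; rewrite linear0 mulmx0 mul0mx; split=> //; exact: psd0.
- move=> t v t0 [/= cv Pv]; split; first by rewrite /= /cst_part mxE mulr_ge0.
  move=> i; have [psdv Qv] := Pv i; rewrite linearZ /=; split; first exact: psdZ.
  by rewrite -scalemxAr -scalemxAl Qv.
- move=> u v [/= cu Pu] [/= cv Pv]; split; first by rewrite /= /cst_part mxE addr_ge0.
  move=> i; have [psdu Qu] := Pu i; have [psdv Qv] := Pv i.
  by rewrite linearD /=; split; [exact: psdD|rewrite mulmxDr mulmxDl Qu Qv].
- move=> v [/= cv Pv] Lv0.
  have tr0 k i : 0 <= \tr (phi (p k) i *m mat i v).
    by apply: mxtrace_psd_ge0 => //; have [] := Pv i.
  have sum0 k : cst_part v + \sum_i \tr (phi (p k) i *m mat i v) = 0.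
    by rewrite -LE Lv0 mxE.
  have cv0 : cst_part v = 0.
    apply/eqP; rewrite eq_le cv andbT -(sum0 0) lerDl.
    by apply: sumr_ge0.
  (* All the traces vanish, so the [p k]-th matrices annihilate [mat i v]. *)
  have mat0 i : mat i v = 0.
    have [psdv Qv] := Pv i; have [_ _ Qker] := Qprop i.
    rewrite -Qv -mulmxA Qker ?mulmx0 // => k.
    apply: mxtrace_psd_eq0 => //; apply/eqP.
    have := sum0 k; rewrite cv0 add0r => /eqP.
    by rewrite psumr_eq0 // => /allP /(_ i); rewrite mem_index_enum => /(_ isT).
  apply/rowP => l; rewrite [RHS]mxE -[l]enum_valK.
  case: (enum_val l) => [[i [j k]]|]; last exact: cv0.
  by have /matrixP /(_ j k) := mat0 i; rewrite matE mxE.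
- exists (cst_part v), (fun i => mat i v); split=> // [i|x Sx].
    by have [] := Pv i.
  have [t [t1 ->]] := spanS x Sx.
  rewrite affine_form_comb //.
  transitivity (\sum_k t k * L v 0 k).
    by apply: eq_bigr => k _; rewrite Lv [in RHS]mxE.
  under eq_bigr do rewrite LE mulrDr.
  rewrite big_split /= -mulr_suml t1 mul1r; congr (_ + _).
  under eq_bigr do rewrite mulr_sumr.
  rewrite exchange_big /=; apply: eq_bigr => i _.
  rewrite phi_comb // mulmx_suml linear_sum; apply: eq_bigr => k _.
  by rewrite -scalemxAl linearZ.
exfalso.
have zsum : 0 <= \sum_k z 0 k.
  have [v [cv mv]] := mk 1 (fun=> 0).
  have := zpos v; rewrite dotE.
  have -> : \sum_j z 0 j * L v 0 j = \sum_k z 0 k.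
    apply: eq_bigr => k _; rewrite LE cv big1 ?addr0 ?mulr1 // => i _.
    by rewrite mv mulmx0 mxtrace0.
  apply; split=> [|i]; first by rewrite /= cv.
  by rewrite mv mulmx0 mul0mx; split=> //; exact: psd0.
have zpsd i (w : 'rV[R]_d) : 0 <= \sum_k z 0 k * (w *m phi (p k) i *m w^T) 0 0.
  have [QQ QA _] := Qprop i.
  (* Compressing the rank one matrix [w^T *m w] does not change its traces. *)
  pose B := (w *m Q i)^T *m (w *m Q i).
  have [v [cv mv]] := mk 0 (fun j => if j == i then B else 0).
  have := zpos v; rewrite dotE.
  have -> : \sum_j z 0 j * L v 0 j = \sum_k z 0 k * (w *m phi (p k) i *m w^T) 0 0.
    apply: eq_bigr => k _; rewrite LE cv add0r (bigD1 i) //= mv eqxx big1 ?addr0; last first.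
      by move=> j /negbTE ji; rewrite mv ji mulmx0 mxtrace0.
    congr (_ * _); rewrite mxtrace_gram_quad big_ord1 row_id.
    have /symP As := phi_sym (p k) i.
    have QAQ : Q i *m phi (p k) i *m (Q i)^T = phi (p k) i.
      by rewrite QA -{1}As -trmx_mul QA As.
    by rewrite trmx_mul !mulmxA -(mulmxA w) -(mulmxA w) QAQ.
  apply; split=> [|j]; first by rewrite /= cv.
  rewrite mv; case: eqP => [->|_]; last by rewrite mulmx0 mul0mx; split=> //; exact: psd0.
  split; first exact: psd_gram.
  have wQQ : w *m Q i *m Q i = w *m Q i by rewrite -mulmxA QQ.
  by rewrite /B (mulmxA (Q i)^T) -trmx_mul wQQ -mulmxA wQQ.
have : 0 <= (z *m (\row_k g (p k))^T) 0 0.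
  rewrite dotE; under eq_bigr do rewrite mxE.
  exact: (barycentre_ge0 g_ge0 Sp).
by rewrite leNgt zneg.
Qed.

End TraceDuality.

End Duality.

(** * Affine polynomials *)

Section AffinePolynomials.
Variables (R : realType) (n : nat).

Definition affine_poly (a : R) (b : 'rV[R]_n) : mpoly n R :=
  mpolyC n a + \sum_j b 0 j *: mpolyX R (mnm1 j).

Lemma affine_poly_eval a b x : mpeval (affine_poly a b) x = a + (x *m b^T) 0 0.
Proof.
rewrite /mpeval /affine_poly mevalD mevalC raddf_sum dotE; congr (_ + _).
by apply: eq_bigr => j _; rewrite /= mevalZ mevalXU mulrC.
Qed.

Lemma msize_affine_poly a b : (mpoly.msize (affine_poly a b) <= 2)%N.
Proof.
apply: (leq_trans (mmeasureD_le _ _ _)).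
rewrite geq_max; apply/andP; split.
  by rewrite mmeasureC; case: (a != 0).
apply: (leq_trans (mmeasure_sum _ _ _ _)); apply/bigmax_leqP => j _.
by apply: (leq_trans (mmeasureZ_le _ _ _)); rewrite msizeX mdeg1.
Qed.

Lemma affine_polyP (f : mpoly n R) : (mpoly.msize f <= 2)%N ->
  exists a b, f = affine_poly a b.
Proof.
move=> f2; exists (mcoeff mnm0 f), (\row_j mcoeff (mnm1 j) f).
apply/mpolyP => m; rewrite /affine_poly mcoeffD mcoeffC raddf_sum /=.
under eq_bigr do rewrite mxE mcoeffZ mcoeffX.
have [m0|m_n0] := eqVneq m mnm0.
  rewrite m0 mulr1 big1 ?addr0 // => j _.
  by rewrite -[_ == _]negbK mnm1_eq0 mulr0.
rewrite mulr0 add0r.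
have [/mdeg1P[j /eqP ->]|m1] := boolP (mdeg m == 1%N).
  rewrite (bigD1 j) //= eqxx mulr1 big1 ?addr0 // => k kj.
  by rewrite eq_mnm1 (negbTE kj) mulr0.
rewrite big1 => [|j _]; last first.
  by case: eqP => [jm|_]; rewrite ?mulr0 //; move: m1; rewrite -jm mdeg1.
apply: memN_msupp_eq0; apply: msize_mdeg_ge; apply: leq_trans f2 _.
by move: m_n0 m1; rewrite -mdeg_eq0; case: (mdeg m) => [|[]].
Qed.

End AffinePolynomials.

(** * Varieties given by algebras of functions *)

Definition rmorph_pack (A B : pzRingType) (f : A -> B) (fB : zmod_morphism f)
    (fM : monoid_morphism f) : {rmorphism A -> B} :=
  HB.pack f (GRing.isZmodMorphism.Build A B f fB) (GRing.isMonoidMorphism.Build A B f fM).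

Section FunctionAlgebra.
Variables (R : realType) (T : Type) (N : nat) (gen : 'I_N -> T -> R).

(** The algebra generated by the functions [gen i]; it is the zero ring if [T] is
    empty. *)
Definition poly_fun : {pred (T -> R)} :=
  fun g => `[< exists p : mpoly N R, forall t, g t = meval (gen^~ t) p >].

Lemma poly_funP g : reflect (exists p : mpoly N R, forall t, g t = meval (gen^~ t) p)
  (g \in poly_fun).
Proof. exact: asboolP. Qed.

Fact poly_fun_subring : subring_closed poly_fun.
Proof.
split.
- by apply/poly_funP; exists 1 => t; rewrite meval1.
- move=> f g /poly_funP[p fE] /poly_funP[q gE]; apply/poly_funP; exists (p - q) => t.
  by rewrite mevalB -fE -gE.
- move=> f g /poly_funP[p fE] /poly_funP[q gE]; apply/poly_funP; exists (p * q) => t.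
  by rewrite mevalM -fE -gE.
Qed.

HB.instance Definition _ := GRing.isSubringClosed.Build (T -> R) poly_fun poly_fun_subring.

Record funalg := Funalg { funalg_val : T -> R; _ : funalg_val \in poly_fun }.

HB.instance Definition _ := [isSub for funalg_val].
HB.instance Definition _ := [Choice of funalg by <:].
HB.instance Definition _ :=
  GRing.SubChoice_isSubComPzRing.Build (T -> R) poly_fun funalg poly_fun_subring.

Lemma funalgP (f g : funalg) : (forall t, \val f t = \val g t) -> f = g.
Proof. by move=> fg; apply/val_inj/funext. Qed.

Definition funalg_of (p : mpoly N R) : funalg :=
  Funalg (introT (poly_funP _) (ex_intro _ p (fun t => erefl (meval (gen^~ t) p)))).

Fact funalg_of_zmod : zmod_morphism funalg_of.
Proof. by move=> p q; apply: funalgP => t; rewrite /= mevalB. Qed.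

Fact funalg_of_monoid : monoid_morphism funalg_of.
Proof. by split=> [|p q]; apply: funalgP => t; rewrite /= ?meval1 ?mevalM. Qed.

Definition funalg_map : {rmorphism mpoly N R -> funalg} :=
  rmorph_pack funalg_of_zmod funalg_of_monoid.

Definition funalg_scalar : {rmorphism R -> funalg} := funalg_map \o @mpolyC N R.

Lemma funalg_scalarE c t : \val (funalg_scalar c) t = c.
Proof. by rewrite /= mevalC. Qed.

Fact funalg_fg : exists (m : nat) (q : {rmorphism mpoly m R -> funalg}),
  (forall c, q (mpolyC m c) = funalg_scalar c) /\ (forall a, exists p, q p = a).
Proof.
exists N, funalg_map; split=> // f.
have /poly_funP[p fE] := valP f; exists p.
by apply: funalgP => t; rewrite fE.
Qed.

Definition function_variety : affine_variety R := AffineVariety funalg_fg.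

Fact funalg_eval_zmod t : zmod_morphism (fun f : funalg => \val f t).
Proof. by []. Qed.

Fact funalg_eval_monoid t : monoid_morphism (fun f : funalg => \val f t).
Proof. by []. Qed.

(** There may be further real points; they can only enlarge the convex hull of
    the image. *)
Definition function_point (t : T) : real_point function_variety :=
  @RealPoint R function_variety
    (rmorph_pack (funalg_eval_zmod t) (funalg_eval_monoid t))
    (funalg_scalarE^~ t).

Section Morphism.
Variables (n : nat) (ev : T -> 'rV[R]_n).
Hypothesis ev_poly : forall j, (fun t => ev t 0 j) \in poly_fun.

Fact pullback_poly_fun (f : mpoly n R) : (fun t => mpeval f (ev t)) \in poly_fun.
Proof.
have cP j : exists p : mpoly N R, forall t, ev t 0 j = meval (gen^~ t) p.
  by have /poly_funP := ev_poly j.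
apply/poly_funP; exists (comp_mpoly [tuple sval (cid (cP j)) | j < n] f) => t.
rewrite comp_mpoly_meval /mpeval; apply: meval_eq => j.
by rewrite tnth_mktuple -(svalP (cid (cP j))).
Qed.

Definition funalg_pullback (f : mpoly n R) : funalg := Funalg (pullback_poly_fun f).

Fact funalg_pullback_zmod : zmod_morphism funalg_pullback.
Proof. by move=> f g; apply: funalgP => t; rewrite /= /mpeval mevalB. Qed.

Fact funalg_pullback_monoid : monoid_morphism funalg_pullback.
Proof.
by split=> [|f g]; apply: funalgP => t; rewrite /= /mpeval ?meval1 ?mevalM.
Qed.

Fact funalg_pullbackC c : funalg_pullback (mpolyC n c) = funalg_scalar c.
Proof. by apply: funalgP => t; rewrite funalg_scalarE /= /mpeval mevalC. Qed.

Definition function_morphism : morphism_to_affine_space function_variety n :=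
  @MorphismToAn R function_variety n
    (rmorph_pack funalg_pullback_zmod funalg_pullback_monoid) funalg_pullbackC.

Lemma function_morphism_point t : point_image function_morphism (function_point t) = ev t.
Proof. by apply/rowP => j; rewrite mxE /= /mpeval mevalXU. Qed.

End Morphism.

End FunctionAlgebra.

Section Spans.
Variables (R : realType) (X : affine_variety R).
Local Notation A := (coord_ring X).
Local Notation sc := (scalar_map X).

Definition spanned_by d (e : 'I_d -> A) : set A :=
  [set u | exists c : 'I_d -> R, u = \sum_i sc (c i) * e i].

Lemma spanned_by_subspace d (e : 'I_d -> A) : linear_subspace (spanned_by e).
Proof.
split; first by exists (fun=> 0); rewrite big1 // => i _; rewrite rmorph0 mul0r.
move=> a _ _ [c ->] [c' ->]; exists (fun i => a * c i + c' i).
rewrite mulr_sumr -big_split /=; apply: eq_bigr => i _.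
by rewrite rmorphD rmorphM mulrDl mulrA.
Qed.

Lemma spanned_by_gen d (e : 'I_d -> A) i : spanned_by e (e i).
Proof.
exists (fun j => (j == i)%:R); rewrite (bigD1 i) //= eqxx rmorph1 mul1r big1 ?addr0 //.
by move=> j /negbTE ->; rewrite rmorph0 mul0r.
Qed.

(** A nontrivial relation allows one to drop a generator. *)
Lemma spanned_by_dim d (e : 'I_d -> A) : dim_le (spanned_by e) d.
Proof.
elim: d e => [|d IH] e.
  by exists 0, e; split=> // [[]|c _ []].
have [free|] := pselect (forall c : 'I_d.+1 -> R,
    \sum_i sc (c i) * e i = 0 -> forall i, c i = 0).
  by exists d.+1, e; split=> // i; exact: spanned_by_gen.
move=> /existsNP[c /not_implyP[cE /existsNP[i /eqP ci]]].
pose e' j := e (lift i j).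
have eE : e i = \sum_j sc (- c (lift i j) / c i) * e' j.
  have : sc (c i)^-1 * \sum_i sc (c i) * e i = 0 by rewrite cE mulr0.
  rewrite (bigD1_ord i) //= mulrDr mulrA -rmorphM mulVf // rmorph1 mul1r.
  move/eqP; rewrite addr_eq0 => /eqP ->; rewrite mulr_sumr -sumrN.
  apply: eq_bigr => j _; rewrite mulrA -rmorphM -mulNr -rmorphN.
  by congr (sc _ * _); rewrite mulNr mulrC.
have [k [b [kd bU bspan bfree]]] := IH e'.
exists k, b; split=> //; first exact: leqW.
  move=> j; have [c' ->] := bU j.
  exists (fun l => if unlift i l is Some l' then c' l' else 0).
  rewrite (bigD1_ord i) //= unlift_none rmorph0 mul0r add0r.
  by apply: eq_bigr => l _; rewrite liftK.
move=> u [c' ->]; apply: bspan; rewrite (bigD1_ord i) //= eE.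
have [_ lin] := spanned_by_subspace e'.
apply: lin; first by eexists.
by exists (fun j => c' (lift i j)).
Qed.

End Spans.

(** The conditions on a representation become conditions on values of functions
    on a set [T] that is mapped onto [K]: the variety is the one of the algebra
    generated by the coordinates of [ev] and by the [u i j], and [U i] is the
    span of the [u i j]. *)
Lemma sos_representable_functions (R : realType) n (K : set 'rV[R]_n) d (T : Type)
    (ev : T -> 'rV[R]_n) r (u : 'I_r -> 'I_d -> T -> R) :
  (forall x, K x -> exists t, ev t = x) ->
  (forall a (b : 'rV[R]_n), (forall x, K x -> 0 <= a + (x *m b^T) 0 0) ->
     exists (c : R) (k : nat) (w : 'I_r -> 'M[R]_(k, d)), 0 <= c /\
       forall t, a + (ev t *m b^T) 0 0 =
                 c + \sum_i \sum_l (\sum_j w i l j * u i j t) ^+ 2) ->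
  sos_representable K d.
Proof.
move=> evK sosK.
pose J : finType := ('I_n + 'I_r * 'I_d)%type.
pose gen (i : 'I_#|J|) (t : T) : R :=
  match enum_val i with inl j => ev t 0 j | inr (i, j) => u i j t end.
have genE (j : J) : (fun t => match j with inl j => ev t 0 j | inr (i, j) => u i j t end)
    \in poly_fun gen.
  apply/poly_funP; exists (mpolyX R (mnm1 (enum_rank j))) => t.
  by rewrite mevalXU /gen enum_rankK.
have ev_poly j : (fun t => ev t 0 j) \in poly_fun gen by exact: (genE (inl j)).
pose X := function_variety gen; pose phi := function_morphism ev_poly.
pose e i j : coord_ring X := Funalg (genE (inr (i, j))).
exists X, phi, r, (fun i => spanned_by (e i)); split.
- move=> x /evK[t <-]; exists 1, (fun=> 1), (fun=> ev t).
  split=> [i|||]; rewrite ?big_ord1 ?scale1r //.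
  by move=> _; exists (function_point gen t) => //; exact: function_morphism_point.
- by move=> i; split; [exact: spanned_by_subspace|exact: spanned_by_dim].
move=> f [/affine_polyP[a [b fE]] f0].
have [|c [k [w [c0 wE]]]] := sosK a b.
  by move=> x /f0; rewrite fE affine_poly_eval.
pose q i l : coord_ring X := \sum_j scalar_map X (w i l j) * e i j.
exists c, (fun i => \sum_(l < k) q i l ^+ 2); split=> // [i|].
  exists k, (q i); split=> // l; exists (fun j => w i l j) => //.
apply: funalgP => t.
pose at_t := point_eval (function_point gen t).
change (mpeval f (ev t) = at_t (scalar_map X c + \sum_i \sum_(l < k) q i l ^+ 2)).
rewrite fE affine_poly_eval wE rmorphD (point_eval_scalar (function_point gen t)).
congr (_ + _); rewrite rmorph_sum; apply: eq_bigr => i _.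
rewrite rmorph_sum; apply: eq_bigr => l _.
rewrite rmorphXn rmorph_sum; congr (_ ^+ 2); apply: eq_bigr => j _.
by rewrite rmorphM (point_eval_scalar (function_point gen t)).
Qed.

(** * Sums of squares from a linear matrix inequality *)

Section UpperBound.
Variable R : realType.

(** Each square involves a single row of [Z]; this is why [d] bounds the dimension
    of the spaces, whatever the number of matrices and of rows. *)
Lemma mxtrace_gram2 d e f (Z : 'M[R]_(e, d)) (W : 'M[R]_(f, d)) :
  \tr (Z^T *m Z *m (W^T *m W)) = \sum_a \sum_l (\sum_j W l j * Z a j) ^+ 2.
Proof.
rewrite mxtrace_gram_quad exchange_big /=; apply: eq_bigr => l _.
rewrite mulmxA -mulmxA -[Z in X in _ *m X]trmxK -trmx_mul dotE.
apply: eq_bigr => a _; rewrite -expr2; congr (_ ^+ 2).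
by rewrite mxE; apply: eq_bigr => j _; rewrite !mxE.
Qed.

Lemma affine_map_form s n (pi : 'rV[R]_s -> 'rV[R]_n) a (b : 'rV[R]_n) : affine_map pi ->
  exists a' (b' : 'rV[R]_s), forall x, a + (pi x *m b^T) 0 0 = a' + (x *m b'^T) 0 0.
Proof.
move=> [L [b0 piE]].
exists (a + (b0 *m b^T) 0 0), (b *m (lin1_mx L)^T) => x.
rewrite piE mulmxDl mxE -mul_rV_lin1 trmx_mul trmxK mulmxA.
by rewrite [X in a + X]addrC addrA.
Qed.

(** An affine function bounded below on an affine subspace is constant on it, so
    that no squares are needed. *)
Lemma sos_representable_affine s n (pi : 'rV[R]_s -> 'rV[R]_n) S :
  affine_map pi -> affine_subspace S -> sos_representable (pi @` S) 0.
Proof.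
move=> piA affS.
apply: (@sos_representable_functions _ _ _ 0 {x | (pi @` S) x} sval 0 (fun _ _ _ => 0)).
  by move=> x Kx; exists (exist _ x Kx).
move=> a b b0.
have [a' [b' abE]] := affine_map_form a b piA.
suff [c c0 cE] : exists2 c, 0 <= c & forall x, S x -> a' + (x *m b'^T) 0 0 = c.
  exists c, 0, (fun=> 0); split=> // -[y Ky] /=.
  by case: Ky => x Sx <-; rewrite big_ord0 addr0 abE cE.
have {}b0 x : S x -> 0 <= a' + (x *m b'^T) 0 0.
  by move=> Sx; rewrite -abE; apply: b0; exists x.
case: affS => [-> | [x0 [W SE]]]; first by exists 0.
have Sx0 : S x0 by rewrite SE /= subrr mem0v.
exists (a' + (x0 *m b'^T) 0 0); first exact: b0.
move=> x Sx; have xW : x - x0 \in W by move: Sx; rewrite SE.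
congr (_ + _).
apply/eqP; rewrite -subr_eq0 -dotBl; apply/eqP.
apply: (@affine_ge0_slope _ _ (a' + (x0 *m b'^T) 0 0)) => t.
have : S (x0 + t *: (x - x0)) by rewrite SE /= addrC addKr memvZ.
move/b0; rewrite dotDl dotZl.
by rewrite [X in _ -> 0 <= X]addrC addrA [X in _ -> 0 <= _ + X]mulrC.
Qed.

(** The matrices at a chosen preimage of each point are factored as [Z^T *m Z]
    with no regard to regularity in the point: the entries of [Z] are just new
    generators of an algebra of functions on the image. *)
Lemma sos_representable_lmi s n (pi : 'rV[R]_s -> 'rV[R]_n) S d :
  affine_map pi -> has_lmi S d -> sos_representable (pi @` S) d.
Proof.
move=> piA [m [phi [_ phiA phi_sym SE]]].
pose T := {x | (pi @` S) x}.
have preim (t : T) : exists x, S x /\ pi x = sval t.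
  by case: t => y Ky; case: (Ky) => x Sx xy; exists x.
pose sigma t := sval (cid (preim t)).
have sigmaS t : S (sigma t) by have [] := svalP (cid (preim t)).
have sigmaE t : pi (sigma t) = sval t by have [] := svalP (cid (preim t)).
have fact t i : exists Z : 'M[R]_d, phi (sigma t) i = Z^T *m Z.
  by apply: psd_factor; have := sigmaS t; rewrite SE.
pose Z t i := sval (cid (fact t i)).
have ZE t i : phi (sigma t) i = (Z t i)^T *m Z t i := svalP (cid (fact t i)).
pose J : finType := ('I_m * 'I_d)%type.
apply: (@sos_representable_functions _ _ _ d T sval #|J|
  (fun q j t => Z t (enum_val q).1 (enum_val q).2 j)).
  by move=> x Kx; exists (exist _ x Kx).
move=> a b b0.
have [a' [b' abE]] := affine_map_form a b piA.
have [|c [B [c0 Bpsd BE]]] := @trace_duality R m d s phi phiA phi_sym a' b'.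
  by move=> x Sx; rewrite -abE; apply: b0; exists x => //; rewrite SE.
have [W WE] : exists W : 'I_m -> 'M[R]_d, forall i, B i = (W i)^T *m W i.
  exists (fun i => sval (cid (psd_factor (Bpsd i)))) => i.
  exact: svalP (cid (psd_factor (Bpsd i))).
exists c, d, (fun q => W (enum_val q).1); split=> // t.
rewrite -sigmaE abE BE; last by have := sigmaS t; rewrite SE.
congr (_ + _).
rewrite (eq_bigr (fun i => \sum_l \sum_k
    (\sum_j W i k j * Z t i l j) ^+ 2)); last first.
  by move=> i _; rewrite ZE WE mxtrace_gram2.
rewrite pair_big /= [LHS](reindex (enum_val : 'I_#|J| -> J)) //=.
exact/onW_bij/enum_val_bij.
Qed.

Theorem sosdeg_le_sxdeg n (K : set 'rV[R]_n) : (sosdeg K <= sxdeg K)%E.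
Proof.
apply: le_ereal_inf_tmp => _ [s [pi [S [_ piA _ <- ->]]]].
rewrite /spdeg; case: asboolP => [affS|_].
  apply: ereal_inf_lbound; exists 0 => //; exact: sos_representable_affine.
apply: le_ereal_inf_tmp => _ [d [_ lmiS] <-].
by apply: ereal_inf_lbound; exists d => //; exact: sos_representable_lmi.
Qed.

End UpperBound.

(** * Linear sections of the cone of positive semidefinite matrices *)

Section LinearSections.
Variable R : realType.

(** For [d > 0] a linear equation is the pair of inequalities saying that both
    signs of a scalar matrix are positive semidefinite; for [d = 0] the set is
    an affine subspace. *)
Lemma spdeg_linear_section s d r q (G : 'I_r -> {linear 'rV[R]_s -> 'M[R]_d})
    (a0 : 'rV[R]_q) (N : 'M[R]_(s, q)) :
  (forall i v, G i v \is symmetricmx) ->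
  (spdeg [set v | (a0 + v *m N = 0)%R /\ forall i, psd (G i v)] <= (d%:R)%:E)%E.
Proof.
move=> Gsym; rewrite /spdeg; case: asboolP => [_|naff]; first by rewrite lee_fin.
apply: ereal_inf_lbound; exists d => //.
have d_gt0 : (0 < d)%N.
  rewrite lt0n; apply/eqP => d0; apply: naff.
  have psd_d v i : psd (G i v).
    split=> // w; suff -> : w = 0 by rewrite mul0mx mul0mx mxE.
    by apply/rowP => j; exfalso; move: (ltn_ord j); rewrite {2}d0.
  have [[x0 [x0E _]]|S0] :=
    pselect ([set v | a0 + v *m N = 0 /\ forall i, psd (G i v)] !=set0); last first.
    left; rewrite -subset0 => x Sx; apply: S0; by exists x.
  right; exists x0, (lker (linfun (mulmxr N))).
  apply/seteqP; split=> x /=; rewrite memv_ker lfunE /= mulmxBl subr_eq0.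
    by move=> [xE _]; rewrite -(can_eq (addKr a0)) xE x0E.
  by move=> /eqP ->.
split=> //.
(* The index [None], with the zero matrix, keeps the family nonempty. *)
pose J : finType := (option ('I_r + bool * 'I_q))%type.
pose sgn (e : bool) : R := (-1) ^+ e.
pose F (v : 'rV[R]_s) (j : J) : 'M[R]_d := match j with
  | None => 0 | Some (inl i) => G i v
  | Some (inr (e, k)) => (sgn e * (v *m N) 0 k)%:M end.
pose b (j : J) : 'M[R]_d := match j with
  | Some (inr (e, k)) => (sgn e * a0 0 k)%:M | _ => 0 end.
have F_lin : linear (fun v => [ffun l : 'I_#|J| => F v (enum_val l)]).
  move=> t u v; apply/ffunP => l; rewrite !ffunE /F.
  case: (enum_val l) => [[i|[e k]]|]; last by rewrite scaler0 addr0.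
    by rewrite linearP.
  rewrite mulmxDl -scalemxAl !mxE scale_scalar_mx -raddfD /=; congr (_%:M); ring.
exists #|J|, (fun v => [ffun l : 'I_#|J| => F v (enum_val l) + b (enum_val l)]).
have scal_psd (t : R) : (forall e, psd ((sgn e * t)%:M : 'M[R]_d)) -> t = 0.
  move=> tp; have := psd_diag_ge0 (Ordinal d_gt0) (tp false).
  have := psd_diag_ge0 (Ordinal d_gt0) (tp true); rewrite !mxE eqxx /sgn.
  by rewrite /= mulr1n mul1r mulN1r; lra.
split.
- by apply/card_gt0P; exists None.
- exists (linear_pack F_lin), [ffun l => b (enum_val l)] => v.
  by apply/ffunP => l; rewrite !ffunE.
- move=> v l; rewrite ffunE /F /b; case: (enum_val l) => [[i|[e k]]|].
  + by rewrite addr0.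
  + by rewrite -raddfD; apply/symP; rewrite tr_scalar_mx.
  + by rewrite addr0; have [] := psd0 R d.
apply/seteqP; split=> v /=.
  move=> [vE Gv] l; rewrite ffunE /F /b; case: (enum_val l) => [[i|[e k]]|].
  - by rewrite addr0.
  - have /rowP /(_ k) := vE; rewrite mxE [RHS]mxE addrC => e0.
    by rewrite -raddfD /= -mulrDr e0 mulr0; exact: psd_scalar.
  - by rewrite addr0; exact: psd0.
move=> h; split; last first.
  move=> i; have := h (enum_rank (Some (inl i) : J)).
  by rewrite ffunE enum_rankK /= addr0.
apply/rowP => k; rewrite mxE [RHS]mxE; apply: scal_psd => e.
have := h (enum_rank (Some (inr (e, k)) : J)).
by rewrite ffunE enum_rankK /= -raddfD -mulrDr addrC.
Qed.

End LinearSections.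

(** * The cone of sums of squares and the squares that it uses *)

Section SosCone.
Variables (R : realType) (n : nat) (K : set 'rV[R]_n).
Variables (X : affine_variety R) (phi : morphism_to_affine_space X n).
Variables (r : nat) (U : 'I_r -> set (coord_ring X)).
Hypothesis U_lin : forall i, linear_subspace (U i).
Local Notation A := (coord_ring X).
Local Notation sc := (scalar_map X).

Definition sos_cone : set A := [set a | exists (c : R) (s : 'I_r -> A),
  [/\ 0 <= c, forall i, sos (U i) (s i) & a = sc c + \sum_i s i]].

Lemma sos0 (V : set A) : sos V 0.
Proof. by exists 0, (fun=> 0); split=> [[]//|]; rewrite big_ord0. Qed.

Lemma sosD (V : set A) a b : sos V a -> sos V b -> sos V (a + b).
Proof.
move=> [k [u [Vu ->]]] [l [v [Vv ->]]].
exists (k + l)%N, (fun i => match fintype.split i with inl i => u i | inr j => v j end).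
split=> [i|]; first by case: fintype.split.
rewrite big_split_ord /=; congr (_ + _); apply: eq_bigr => i _.
  by rewrite (unsplitK (inl i : 'I_k + 'I_l)).
by rewrite (unsplitK (inr i : 'I_k + 'I_l)).
Qed.

Lemma sos_sqr (V : set A) u : V u -> sos V (u ^+ 2).
Proof. by move=> Vu; exists 1, (fun=> u); split=> //; rewrite big_ord1. Qed.

Lemma sos_cone0 : sos_cone 0.
Proof.
by exists 0, (fun=> 0); split=> // [i|]; [exact: sos0|rewrite rmorph0 big1 ?addr0].
Qed.

Lemma sos_coneD a b : sos_cone a -> sos_cone b -> sos_cone (a + b).
Proof.
move=> [c [s [c0 ss ->]]] [c' [s' [c'0 ss' ->]]].
exists (c + c'), (fun i => s i + s' i); split=> [|i|].
- exact: addr_ge0.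
- exact: sosD.
- by rewrite rmorphD big_split addrACA.
Qed.

Lemma sos_cone_scalar c : 0 <= c -> sos_cone (sc c).
Proof.
by move=> c0; exists c, (fun=> 0); split=> // [i|]; [exact: sos0|rewrite big1 ?addr0].
Qed.

Lemma sos_cone_sos i s : sos (U i) s -> sos_cone s.
Proof.
move=> Us; exists 0, (fun j => if j == i then s else 0); split=> // [j|].
  by case: eqP => [->|_]; [|exact: sos0].
rewrite rmorph0 add0r (bigD1 i) //= eqxx big1 ?addr0 // => j /negbTE ->.
by [].
Qed.

Lemma sos_cone_sum k (a : 'I_k -> A) (P : pred 'I_k) :
  (forall i, sos_cone (a i)) -> sos_cone (\sum_(i | P i) a i).
Proof.
move=> h; elim/big_ind: _ => [|x y|i _]; [exact: sos_cone0|exact: sos_coneD|exact: h].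
Qed.

(** The spans of these elements still suffice to represent all of
    [nonneg_affine K], and each of the elements comes with an affine function
    that dominates its square.  This is what bounds the dual spectrahedron in
    terms of its projection. *)
Definition used_squares i : set A := [set u | U i u /\
  exists f a, [/\ nonneg_affine K f, sos_cone a & pullback phi f = a + u ^+ 2]].

(** A square occurring in [a] can be set aside, and the rest is still in the
    cone.  The summand [b] allows one to apply this to what remains of
    [pullback phi f] after one particular square has been removed. *)
Lemma used_squares_decomp f a b : nonneg_affine K f -> sos_cone a -> sos_cone b ->
  pullback phi f = a + b ->
  exists (c : R) (k : 'I_r -> nat) (u : forall i, 'I_(k i) -> A),
    [/\ 0 <= c, forall i l, used_squares i (u i l)
      & a = sc c + \sum_i \sum_l u i l ^+ 2].
Proof.
move=> fK [c [s [c0 ss aE]]] bC fE.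
pose k i := sval (cid (ss i)).
pose u i := sval (cid (svalP (cid (ss i)))) : 'I_(k i) -> A.
have uP i : (forall l, U i (u i l)) /\ s i = \sum_l u i l ^+ 2.
  exact: svalP (cid (svalP (cid (ss i)))).
exists c, k, u; split=> //; last by rewrite aE; congr (_ + _); apply: eq_bigr => i _; case: (uP i).
move=> i l; split; first by case: (uP i).
exists f, (sc c + \sum_(j | j != i) s j + \sum_(l' | l' != l) u i l' ^+ 2 + b).
split=> //; last first.
  rewrite fE aE (bigD1 i) //=; have [_ ->] := uP i; rewrite (bigD1 l) //=.
  by rewrite -!addrA; congr (_ + _); rewrite addrC -!addrA [RHS]addrCA.
apply: sos_coneD => //; apply: sos_coneD; first apply: sos_coneD.
- exact: sos_cone_scalar.
- by apply: sos_cone_sum => j; apply: sos_cone_sos (ss j).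
- apply: sos_cone_sum => l'; apply: (@sos_cone_sos i); apply: sos_sqr.
  by case: (uP i).
Qed.

Lemma nonneg_affine0 : nonneg_affine K 0.
Proof.
split=> [|x _]; last by rewrite /mpeval meval0.
by rewrite mmeasure0.
Qed.

Lemma used_squares0 i : used_squares i 0.
Proof.
have [U0 _] := U_lin i; split=> //; exists 0, 0; split.
- exact: nonneg_affine0.
- exact: sos_cone0.
- by rewrite rmorph0 expr0n addr0.
Qed.

Lemma used_squares_spanning d i : dim_le (U i) d ->
  exists e : 'I_d -> A, (forall j, used_squares i (e j)) /\
    forall u, used_squares i u -> exists z : 'rV[R]_d, u = \sum_j sc (z 0 j) * e j.
Proof.
move=> [k [e0 [kd Ue0 e0span _]]].
pose comb (c : 'rV[R]_k) : A := \sum_j sc (c 0 j) * e0 j.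
have combP u : U i u -> exists c, comb c = u.
  move=> /e0span[c ->]; exists (\row_j c j).
  by apply: eq_bigr => j _; rewrite mxE.
have comb_lin l (D : 'rV[R]_l) (M : 'M[R]_(l, k)) :
    comb (D *m M) = \sum_j sc (D 0 j) * comb (row j M).
  rewrite /comb; under [RHS]eq_bigr do rewrite mulr_sumr.
  rewrite exchange_big /=; apply: eq_bigr => j _.
  rewrite mxE rmorph_sum mulr_suml; apply: eq_bigr => q _.
  by rewrite rmorphM mulrA mxE.
have [|M [MY spM]] := @spanning_rows R k d [set c | used_squares i (comb c)] _ kd.
  have [c cE] := combP 0 (proj1 (U_lin i)).
  by exists c; rewrite /= cE; exact: used_squares0.
exists (fun j => comb (row j M)); split=> // u uu.
have [c cE] := combP u (proj1 uu).
have /submxP[D cD] : (c <= M)%MS by apply: spM; rewrite /= cE.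
by exists D; rewrite -cE cD comb_lin.
Qed.

Section Gram.
Variables (d : nat) (e : 'I_r -> 'I_d -> A).
Hypothesis e_used : forall i j, used_squares i (e i j).
Hypothesis e_span : forall i u, used_squares i u ->
  exists z : 'rV[R]_d, u = \sum_j sc (z 0 j) * e i j.

(** The pairing of [Z] with the Gram matrices of the [e i]. *)
Definition gram_expr (Z : 'I_r -> 'M[R]_d) : A :=
  \sum_i \sum_j \sum_k sc (Z i j k) * (e i j * e i k).

Definition gram_cone : set A := [set a | exists (c : R) (Z : 'I_r -> 'M[R]_d),
  [/\ 0 <= c, forall i, psd (Z i) & a = sc c + gram_expr Z]].

Lemma gram_exprD Z Z' : gram_expr (fun i => Z i + Z' i) = gram_expr Z + gram_expr Z'.
Proof.
rewrite /gram_expr -big_split; apply: eq_bigr => i _.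
rewrite -big_split; apply: eq_bigr => j _.
rewrite -big_split; apply: eq_bigr => k _.
by rewrite mxE rmorphD mulrDl.
Qed.

Lemma gram_coneD a b : gram_cone a -> gram_cone b -> gram_cone (a + b).
Proof.
move=> [c [Z [c0 Zp ->]]] [c' [Z' [c'0 Zp' ->]]].
exists (c + c'), (fun i => Z i + Z' i); split=> [|i|].
- exact: addr_ge0.
- exact: psdD.
- by rewrite rmorphD gram_exprD addrACA.
Qed.

Lemma gram_cone_scalar c : 0 <= c -> gram_cone (sc c).
Proof.
move=> c0; exists c, (fun=> 0); split=> // [i|]; first exact: psd0.
rewrite /gram_expr big1 ?addr0 // => i _; rewrite big1 // => j _.
by rewrite big1 // => k _; rewrite mxE rmorph0 mul0r.
Qed.

Lemma gram_cone_sqr i u : used_squares i u -> gram_cone (u ^+ 2).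
Proof.
move=> /e_span[z ->].
exists 0, (fun j => if j == i then z^T *m z else 0); split=> // [j|].
  by case: eqP => _; [exact: psd_gram|exact: psd0].
rewrite rmorph0 add0r /gram_expr (bigD1 i) //= eqxx [X in _ + X]big1 ?addr0; last first.
  move=> j /negbTE ->; rewrite big1 // => k _.
  by rewrite big1 // => l _; rewrite mxE rmorph0 mul0r.
rewrite expr2 mulr_suml; apply: eq_bigr => j _.
rewrite mulr_sumr; apply: eq_bigr => k _.
by rewrite mxE big_ord1 mxE rmorphM mulrACA.
Qed.

Lemma gram_cone_decomp f a b : nonneg_affine K f -> sos_cone a -> sos_cone b ->
  pullback phi f = a + b -> gram_cone a.
Proof.
move=> fK aC bC fE.
have [c [k [u [c0 uu ->]]]] := used_squares_decomp fK aC bC fE.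
apply: gram_coneD; first exact: gram_cone_scalar.
have g0 : gram_cone 0 by rewrite -(rmorph0 sc); exact: gram_cone_scalar.
elim/big_ind: _ => [|x y|i _]; [exact: g0|exact: gram_coneD|].
elim/big_ind: _ => [|x y|l _]; [exact: g0|exact: gram_coneD|].
exact: gram_cone_sqr (uu i l).
Qed.

End Gram.

End SosCone.

(** * The spectrahedron of normalized functionals *)

Section DualSpectrahedron.
Variables (R : realType) (n : nat) (K : set 'rV[R]_n).
Variables (X : affine_variety R) (phi : morphism_to_affine_space X n).
Variables (r : nat) (U : 'I_r -> set (coord_ring X)).
Local Notation A := (coord_ring X).
Local Notation sc := (scalar_map X).
Hypothesis K_conv : conv_closed K.
Hypothesis K_sub : K `<=` conv_hull (range (point_image phi)).
Hypothesis repr : forall f, nonneg_affine K f -> sos_cone U (pullback phi f).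

Variables (d : nat) (e : 'I_r -> 'I_d -> A).
Hypothesis e_used : forall i j, used_squares K phi U i (e i j).
Hypothesis e_span : forall i u, used_squares K phi U i u ->
  exists z : 'rV[R]_d, u = \sum_j sc (z 0 j) * e i j.

Let J : finType := ('I_n + 'I_r * ('I_d * 'I_d))%type.
Local Notation s := #|J|.

(** Together with [1] these span the domain of the functionals: the coordinates
    that define the projection and the entries of the Gram matrices. *)
Definition dual_gen (l : J) : A := match l with
  | inl j => pullback phi (mpolyX R (mnm1 j))
  | inr (i, (j, k)) => e i j * e i k end.

Let val_at (v : 'rV[R]_s) (l : J) : R := v 0 (enum_rank l).

(** The linear relations between [1], whose coefficient comes first, and the
    [dual_gen]s.  A vector of prescribed values extends to a functional with
    value [1] at [1] exactly if it satisfies all of them. *)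
Definition relation : set 'rV[R]_(1 + s) := [set rho |
  sc (rho 0 (lshift s 0)) + \sum_l sc (rho 0 (rshift 1 (enum_rank l))) * dual_gen l = 0].

Lemma dual_coords : exists pi : {linear 'rV[R]_s -> 'rV[R]_n},
  forall v j, pi v 0 j = val_at v (inl j).
Proof.
have lin : linear (fun v : 'rV[R]_s => \row_j val_at v (inl j) : 'rV[R]_n).
  by move=> t u v; apply/rowP => j; rewrite !mxE /val_at !mxE.
by exists (linear_pack lin) => v j; rewrite mxE.
Qed.

(** Symmetrized, since the matrices of a linear matrix inequality have to be
    symmetric also where the relations fail. *)
Lemma dual_gram : exists G : 'I_r -> {linear 'rV[R]_s -> 'M[R]_d},
  forall i v j k, G i v j k = val_at v (inr (i, (j, k))) + val_at v (inr (i, (k, j))).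
Proof.
have lin i : linear (fun v : 'rV[R]_s => \matrix_(j, k)
    (val_at v (inr (i, (j, k))) + val_at v (inr (i, (k, j)))) : 'M[R]_d).
  move=> t u v; apply/matrixP => j k; rewrite !mxE /val_at !mxE; ring.
by exists (fun i => linear_pack (lin i)) => i v j k; rewrite mxE.
Qed.

Lemma dual_relations : exists M : 'M[R]_(1 + s),
  (forall k, relation (row k M)) /\ forall rho, relation rho -> (rho <= M)%MS.
Proof.
apply: spanning_rows => //; exists 0; rewrite /relation /= mxE rmorph0 add0r.
by rewrite big1 // => l _; rewrite mxE rmorph0 mul0r.
Qed.

Variables (pi : {linear 'rV[R]_s -> 'rV[R]_n}) (G : 'I_r -> {linear 'rV[R]_s -> 'M[R]_d}).
Variable M : 'M[R]_(1 + s).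
Hypothesis piE : forall v j, pi v 0 j = val_at v (inl j).
Hypothesis GE : forall i v j k,
  G i v j k = val_at v (inr (i, (j, k))) + val_at v (inr (i, (k, j))).
Hypothesis M_rel : forall k, relation (row k M).
Hypothesis M_span : forall rho, relation rho -> (rho <= M)%MS.

Definition dual_spectrahedron : set 'rV[R]_s := [set v |
  (lsubmx M)^T + v *m (rsubmx M)^T = 0 /\ forall i, psd (G i v)].

Lemma relation_eval v (rho : 'rV[R]_(1 + s)) : (row_mx 1%:M v *m rho^T) 0 0 =
  rho 0 (lshift s 0) + \sum_l rho 0 (rshift 1 (enum_rank l)) * val_at v l.
Proof.
rewrite dotE big_split_ord /= big_ord1 row_mxEl mxE eqxx mul1r; congr (_ + _).
rewrite (reindex (enum_rank : J -> 'I_s)) /=; last exact/onW_bij/enum_rank_bij.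
by apply: eq_bigr => l _; rewrite row_mxEr mulrC.
Qed.

Lemma relation_mx v : row_mx 1%:M v *m M^T = (lsubmx M)^T + v *m (rsubmx M)^T.
Proof. by rewrite -{1}[M]hsubmxK tr_row_mx mul_row_col mul1mx. Qed.

Lemma dual_relation v rho : dual_spectrahedron v -> relation rho ->
  rho 0 (lshift s 0) + \sum_l rho 0 (rshift 1 (enum_rank l)) * val_at v l = 0.
Proof.
move=> [vM _] /M_span/submxP[D ->].
by rewrite -relation_eval trmx_mul mulmxA relation_mx vM mul0mx mxE.
Qed.

Lemma dual_relation_fun v (a : R) (c : J -> R) : dual_spectrahedron v ->
  sc a + \sum_l sc (c l) * dual_gen l = 0 -> a + \sum_l c l * val_at v l = 0.
Proof.
move=> Sv ac0.
have := @dual_relation v (row_mx a%:M (pack c)) Sv.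
rewrite /relation /= row_mxEl mxE eqxx mulr1n.
under eq_bigr do rewrite row_mxEr packE.
under [X in (_ -> _ + X = _) -> _]eq_bigr do rewrite row_mxEr packE.
exact.
Qed.

Definition gram_val (v : 'rV[R]_s) (Z : 'I_r -> 'M[R]_d) : R :=
  \sum_i \sum_j \sum_k Z i j k * val_at v (inr (i, (j, k))).

Lemma gram_val_ge0 v Z : dual_spectrahedron v -> (forall i, psd (Z i)) -> 0 <= gram_val v Z.
Proof.
move=> [_ Gv] Zp; apply: sumr_ge0 => i _.
have := mxtrace_psd_ge0 (Gv i) (Zp i); rewrite /mxtrace.
suff -> : \sum_j (G i v *m Z i) j j =
    (\sum_j \sum_k Z i j k * val_at v (inr (i, (j, k)))) *+ 2 by rewrite pmulrn_lge0.
have [/symP Zs _] := Zp i.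
rewrite mulr2n {2}exchange_big -big_split /=; apply: eq_bigr => j _.
rewrite mxE -big_split /=; apply: eq_bigr => k _.
have -> : Z i k j = Z i j k by rewrite -[in LHS]Zs mxE.
by rewrite GE mulrC mulrDr.
Qed.

Lemma pullback_affine a b : pullback phi (affine_poly a b) =
  sc a + \sum_j sc (b 0 j) * pullback phi (mpolyX R (mnm1 j)).
Proof.
rewrite rmorphD pullbackC rmorph_sum; congr (_ + _); apply: eq_bigr => j _.
by rewrite -mul_mpolyC rmorphM pullbackC.
Qed.

(** Applies the functional with values [v] to an identity in the coordinate
    ring. *)
Lemma dual_transfer v a b c Z : dual_spectrahedron v ->
  pullback phi (affine_poly a b) = sc c + gram_expr e Z ->
  a + (pi v *m b^T) 0 0 = c + gram_val v Z.
Proof.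
move=> Sv abE.
pose coef (l : J) : R := match l with inl j => b 0 j | inr (i, (j, k)) => - Z i j k end.
have splitJ (V : nmodType) (F : J -> V) : \sum_l F l =
    \sum_j F (inl j) + \sum_i \sum_j \sum_k F (inr (i, (j, k))).
  rewrite big_sumType /=; congr (_ + _).
  transitivity (\sum_i \sum_(jk : 'I_d * 'I_d) F (inr (i, jk))).
    by rewrite pair_big /=; apply: eq_bigr => -[i jk].
  apply: eq_bigr => i _; rewrite pair_big /=.
  by apply: eq_bigr => -[j k].
have := @dual_relation_fun v (a - c) coef Sv.
rewrite !splitJ /=.
have -> : \sum_i \sum_j \sum_k sc (- Z i j k) * (e i j * e i k) = - gram_expr e Z.
  rewrite /gram_expr -sumrN; apply: eq_bigr => i _.
  rewrite -sumrN; apply: eq_bigr => j _.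
  by rewrite -sumrN; apply: eq_bigr => k _; rewrite rmorphN mulNr.
have -> : \sum_i \sum_j \sum_k - Z i j k * val_at v (inr (i, (j, k))) = - gram_val v Z.
  rewrite /gram_val -sumrN; apply: eq_bigr => i _.
  rewrite -sumrN; apply: eq_bigr => j _.
  by rewrite -sumrN; apply: eq_bigr => k _; rewrite mulNr.
have -> : (pi v *m b^T) 0 0 = \sum_j b 0 j * val_at v (inl j).
  by rewrite dotE; apply: eq_bigr => j _; rewrite piE mulrC.
move=> h; apply/eqP; rewrite -subr_eq0 opprD addrACA; apply/eqP/h.
by rewrite rmorphB addrACA -opprD -pullback_affine abE subrr.
Qed.

(** By separation it suffices to consider affine functions nonnegative on [K]; the
    functional is nonnegative on their representations. *)
Lemma dual_image_closure v : dual_spectrahedron v -> closure K (pi v).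
Proof.
move=> Sv; apply: separation_closure => // a b ab_ge0.
have fK : nonneg_affine K (affine_poly a b).
  by split=> [|x Kx]; [exact: msize_affine_poly|rewrite affine_poly_eval; exact: ab_ge0].
have [c [Z [c0 Zp fE]]] : gram_cone e (pullback phi (affine_poly a b)).
  apply: (gram_cone_decomp e_span fK (repr fK) (sos_cone0 U)).
  by rewrite addr0.
by rewrite (dual_transfer Sv fE) addr_ge0 // gram_val_ge0.
Qed.

Definition point_values (x : real_point X) : 'rV[R]_s :=
  pack (fun l : J => point_eval x (dual_gen l)).

Lemma point_values_relation x rho : relation rho ->
  rho 0 (lshift s 0) + \sum_l rho 0 (rshift 1 (enum_rank l)) * val_at (point_values x) l = 0.
Proof.
move=> /(congr1 (point_eval x)); rewrite rmorph0 rmorphD rmorph_sum point_eval_scalar.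
move=> rel0; apply: etrans rel0; congr (_ + _); apply: eq_bigr => l _.
by rewrite rmorphM point_eval_scalar /val_at packE.
Qed.

Lemma point_values_eqn x : (lsubmx M)^T + point_values x *m (rsubmx M)^T = 0.
Proof.
rewrite -relation_mx; apply/rowP => k; rewrite [RHS]mxE.
have -> (u : 'rV[R]_(1 + s)) : (u *m M^T) 0 k = (u *m (row k M)^T) 0 0.
  by rewrite !mxE; apply: eq_bigr => j _; rewrite !mxE.
by rewrite relation_eval point_values_relation.
Qed.

Lemma point_values_gram x i : psd (G i (point_values x)).
Proof.
pose g : 'rV[R]_d := \row_j point_eval x (e i j).
have -> : G i (point_values x) = 2 *: (g^T *m g).
  apply/matrixP => j k; rewrite GE /val_at !packE /= !rmorphM !mxE big_ord1 !mxE.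
  by rewrite [X in _ + X]mulrC mulr_natl mulr2n.
by apply: psdZ => //; exact: psd_gram.
Qed.

Lemma subset_dual_image : K `<=` pi @` dual_spectrahedron.
Proof.
move=> y /K_sub[k [t [p [t0 t1 pP ->]]]].
pose x l := sval (cid2 (pP l)).
have xE l : point_image phi (x l) = p l := s2valP' (cid2 (pP l)).
exists (\sum_l t l *: point_values (x l)).
  split.
    have eqn_affine : affine_map (fun v : 'rV[R]_s => (lsubmx M)^T + v *m (rsubmx M)^T).
      by exists (mulmxr (rsubmx M)^T), (lsubmx M)^T => v; rewrite addrC.
    rewrite (affine_map_comb _ eqn_affine t1) big1 // => l _.
    by rewrite point_values_eqn scaler0.
  move=> i; rewrite linear_sum; apply: psd_sum => l; rewrite linearZ /=.
  by apply: psdZ => //; exact: point_values_gram.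
rewrite linear_sum; apply: eq_bigr => l _; rewrite linearZ /= -xE.
by congr (_ *: _); apply/rowP => j; rewrite piE /val_at packE mxE.
Qed.

Lemma dual_spectrahedron_closed : closed dual_spectrahedron.
Proof.
have -> : dual_spectrahedron = [set v | forall k, (row_mx 1%:M v *m M^T) 0 k = 0] `&`
    [set v | forall i, psd (G i v)].
  apply/seteqP; split=> v [vM Gv]; split=> //.
    by move=> k; rewrite relation_mx vM mxE.
  by rewrite -relation_mx; apply/rowP => k; rewrite vM mxE.
apply: closedI; apply: closed_forall => i; last exact: psd_preimage_closed.
apply: closed_eq0.
have -> : (fun v : 'rV[R]_s => (row_mx 1%:M v *m M^T) 0 i) =
    (fun v => (lsubmx M)^T 0 i + (v *m (rsubmx M)^T) 0 i).
  by apply/funext => v; rewrite relation_mx mxE.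
move=> v; apply: continuousD; first exact: cst_continuous.
exact: (@linear_coord_continuous R s 1 (1 + s) (mulmxr (rsubmx M)^T) 0 i).
Qed.

Lemma dual_spectrahedron_convex : conv_closed dual_spectrahedron.
Proof.
move=> t u v /andP[t0 t1] [uM Gu] [vM Gv]; split.
  have -> : (lsubmx M)^T + ((1 - t) *: u + t *: v) *m (rsubmx M)^T =
      (1 - t) *: ((lsubmx M)^T + u *m (rsubmx M)^T) +
      t *: ((lsubmx M)^T + v *m (rsubmx M)^T).
    rewrite mulmxDl -!scalemxAl !scalerDr addrACA -scalerDl.
    by rewrite subrK scale1r.
  by rewrite uM vM !scaler0 addr0.
move=> i; rewrite linearD !linearZ /=; apply: psdD; apply: psdZ => //.
by rewrite subr_ge0.
Qed.

(** The affine function is one that dominates the used square [e i j ^+ 2]: the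
    difference is represented by used squares, hence has a nonnegative value. *)
Lemma gram_diag_le i j : exists a (b : 'rV[R]_n), forall v, dual_spectrahedron v ->
  val_at v (inr (i, (j, j))) <= a + (pi v *m b^T) 0 0.
Proof.
have [Ue [f [a [fK aC fE]]]] := e_used i j.
have [c [Z [c0 Zp aE]]] : gram_cone e a.
  apply: (gram_cone_decomp e_span fK aC _ fE).
  by apply: (@sos_cone_sos _ _ _ _ i); exact: sos_sqr.
have [a' [b fab]] := affine_polyP (proj1 fK).
exists a', b => v Sv.
pose D i' : 'M[R]_d := if i' == i then delta_mx j j else 0.
have DE (V : nmodType) (F : 'I_r -> 'I_d -> 'I_d -> R -> V) :
    (forall i' j' k', F i' j' k' 0 = 0) ->
    \sum_i' \sum_j' \sum_k' F i' j' k' (D i' j' k') = F i j j 1.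
  move=> F0; rewrite (bigD1 i) //= [X in _ + X]big1 ?addr0; last first.
    move=> i' /negbTE i'i; rewrite big1 // => j' _; rewrite big1 // => k' _.
    by rewrite /D i'i mxE F0.
  rewrite /D eqxx (bigD1 j) //= [X in _ + X]big1 ?addr0; last first.
    by move=> j' /negbTE jj; rewrite big1 // => k' _; rewrite mxE jj F0.
  rewrite (bigD1 j) //= mxE !eqxx big1 ?addr0 // => k' /negbTE kj.
  by rewrite mxE kj andbF F0.
have fZ : pullback phi (affine_poly a' b) = sc c + gram_expr e (fun i' => Z i' + D i').
  rewrite -fab fE aE gram_exprD addrA; congr (_ + _).
  rewrite /gram_expr (DE _ (fun i' j' k' z => sc z * (e i' j' * e i' k'))).
    by rewrite rmorph1 mul1r.
  by move=> i' j' k'; rewrite rmorph0 mul0r.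
rewrite (dual_transfer Sv fZ).
have -> : gram_val v (fun i' => Z i' + D i') = gram_val v Z + val_at v (inr (i, (j, j))).
  rewrite -[in RHS](mul1r (val_at v _)).
  rewrite -(DE _ (fun i' j' k' z => z * val_at v (inr (i', (j', k'))))); last first.
    by move=> i' j' k'; rewrite mul0r.
  rewrite /gram_val -big_split; apply: eq_bigr => i' _.
  rewrite -big_split; apply: eq_bigr => j' _.
  rewrite -big_split; apply: eq_bigr => k' _.
  by rewrite mxE mulrDl.
by rewrite addrA lerDr addr_ge0 // gram_val_ge0.
Qed.

Lemma dual_sym v i j k : dual_spectrahedron v ->
  val_at v (inr (i, (j, k))) = val_at v (inr (i, (k, j))).
Proof.
move=> Sv; apply/eqP; rewrite -subr_eq0; apply/eqP.
have [->|jk] := eqVneq j k; first by rewrite subrr.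
pose l1 : J := inr (i, (j, k)); pose l2 : J := inr (i, (k, j)).
have l12 : l2 != l1 by apply: contra jk => /eqP[_ ->].
pose c l : R := (l == l1)%:R - (l == l2)%:R.
have cE (V : zmodType) (F : J -> R -> V) : (forall l, F l 0 = 0) ->
    \sum_l F l (c l) = F l1 1 + F l2 (-1).
  move=> F0; rewrite (bigD1 l1) //= (bigD1 l2) //= big1 ?addr0.
    by rewrite /c !eqxx (negbTE l12) eq_sym (negbTE l12) subr0 sub0r.
  by move=> l /andP[/negbTE ll1 /negbTE ll2]; rewrite /c ll1 ll2 subrr F0.
have := @dual_relation_fun v 0 c Sv.
rewrite (cE _ (fun l z => sc z * dual_gen l)); last by move=> l; rewrite rmorph0 mul0r.
rewrite (cE _ (fun l z => z * val_at v l)); last by move=> l; rewrite mul0r.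
rewrite !mul1r mulN1r !add0r; apply.
by rewrite rmorph0 rmorphN rmorph1 mulN1r mul1r add0r /= [X in X - _]mulrC subrr.
Qed.

(** The diagonals of the Gram matrices are bounded by affine functions of the
    projection, and the diagonal of a positive semidefinite matrix bounds its
    other entries. *)
Lemma dual_bounded (y : 'rV[R]_n) (c : R) : exists C : R, forall v, dual_spectrahedron v ->
  ((pi v - y) *m (pi v - y)^T) 0 0 <= c -> forall l, `|v 0 l| <= C.
Proof.
have diag i j := cid (gram_diag_le i j).
pose da i j := sval (diag i j); pose db i j := sval (cid (svalP (diag i j))).
have dP i j v : dual_spectrahedron v ->
    val_at v (inr (i, (j, j))) <= da i j + (pi v *m (db i j)^T) 0 0.
  exact: (svalP (cid (svalP (diag i j)))).
pose B := \sum_j `|y 0 j| + (c + 1).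
pose D i j := `|da i j| + \sum_l B * `|db i j 0 l|.
pose C := `|B| + \sum_i \sum_j `|D i j|.
exists C => v Sv vc.
have yB j : `|pi v 0 j| <= B by exact: coord_le_dist.
have vD i j : val_at v (inr (i, (j, j))) <= D i j.
  apply: le_trans (dP i j v Sv) _; rewrite lerD ?ler_norm // dotE ler_sum // => l _.
  by rewrite (le_trans (ler_norm _)) // normrM ler_wpM2r.
have D_C i j : D i j <= C.
  rewrite (le_trans (ler_norm _)) // /C (bigD1 i) //= (bigD1 j) //=.
  apply: ler_wpDl => //; apply: ler_wpDr; last by rewrite lerDl sumr_ge0.
  by apply: sumr_ge0 => i' _; apply: sumr_ge0.
have [_ Gv] := Sv.
move=> l; rewrite -[l]enum_valK; case: (enum_val l) => [j|[i [j k]]].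
  have := yB j; rewrite piE /val_at => h; apply: (le_trans h).
  rewrite (le_trans (ler_norm _)) // lerDl sumr_ge0 // => i _.
  exact: sumr_ge0.
have := psd_entry_le j k (Gv i); rewrite !GE -!mulr2n -(dual_sym i j k Sv) -mulr2n.
have := le_trans (vD i j) (D_C i j); have := le_trans (vD i k) (D_C i k).
rewrite normrMn /val_at; move: (`|_|) => w.
lra.
Qed.

Theorem dual_image : pi @` dual_spectrahedron = closure K.
Proof.
apply/seteqP; split=> [_ [v Sv <-]|x Kx]; first exact: dual_image_closure.
apply: closed_image_mem.
- by move=> c; exact: dual_bounded.
- exact: dual_spectrahedron_closed.
- exact: dual_spectrahedron_convex.
- by apply: (closure_sub _ _ Kx) => [|y /subset_dual_image/subset_closure //]; exact: closed_closure.
Qed.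

End DualSpectrahedron.

(** * The two inequalities *)

Lemma convex_set_conv_closed (R : realType) n (K : set 'rV[R]_n) :
  @convex_set R 'rV[R]_n K -> conv_closed K.
Proof.
move=> Kcv t x y /andP[t0 t1] Kx Ky.
have := Kcv y x (Itv01 t0 t1) (mem_set Ky) (mem_set Kx).
by move=> /set_mem; rewrite addrC.
Qed.

(** The spectrahedron of functionals on the spaces spanned by used squares has
    blocks of size [d] and projects onto the closure of [K]. *)
Theorem sxdeg_closure_le_sosdeg (R : realType) n (K : set 'rV[R]_n) :
  (0 < n)%N -> conv_closed K -> (sxdeg (closure K) <= sosdeg K)%E.
Proof.
move=> n0 Kcv; apply: le_ereal_inf_tmp => _ [d [X [phi [r [U [Ksub Udim repr]]]]] <-].
have U_lin i := proj1 (Udim i).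
have spanning i := cid (used_squares_spanning K phi U_lin (proj2 (Udim i))).
pose e i := sval (spanning i).
have e_used i j : used_squares K phi U i (e i j) := proj1 (svalP (spanning i)) j.
have e_span i u : used_squares K phi U i u ->
  exists z : 'rV[R]_d, u = \sum_j scalar_map X (z 0 j) * e i j :=
  proj2 (svalP (spanning i)) u.
have [pi piE] := dual_coords R n r d.
have [G GE] := dual_gram R n r d.
have [M [M_rel M_span]] := dual_relations phi e.
have image := dual_image Kcv Ksub repr e_used e_span piE GE M_rel M_span.
have le_d : (spdeg (dual_spectrahedron G M) <= (d%:R)%:E)%E.
  apply: spdeg_linear_section => i v; apply/symP/matrixP => j k.
  by rewrite mxE !GE addrC.
apply: (le_trans _ le_d); apply: ereal_inf_lbound.
eexists; exists (pi : _ -> _), (dual_spectrahedron G M); split => //.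
- by rewrite card_sum card_ord ltn_addr.
- by exists pi, 0 => v; rewrite addr0.
- exact: le_lt_trans le_d (ltry _).
Qed.

Theorem theorem2p10 (R : realType) (n : nat) (K : set 'rV[R]_n)
    (n_gt0 : (0 < n)%N)
    (K_convex : @convex_set R 'rV[R]_n K)
    (K_semialgebraic : semialgebraic K) :
  [/\ (sxdeg (closure K) <= sosdeg K)%E,
      (sosdeg K <= sxdeg K)%E
    & closed K -> sxdeg K = sosdeg K].
Proof.
have lower := sxdeg_closure_le_sosdeg n_gt0 (convex_set_conv_closed K_convex).
have upper := sosdeg_le_sxdeg K.
split=> // Kcl; apply/eqP; rewrite eq_le upper andbT.
by move: lower; rewrite -(proj1 (closure_id K) Kcl).
Qed.
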